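(* Let $G$ be an unbounded countable abelian group. Then the set of all invariant metrics $d$ on $G$ such that $(G,d)$ is isometric to the rational Urysohn space $\mathbb{Q}\mathbb{U}$ is dense in the space of all invariant metrics on $G$. Moreover, the set of all invariant metrics $d$ on $G$ such that the completion of $(G,d)$ is isometric to the Urysohn space $\mathbb{U}$ is a dense $G_\delta$ subset of the space of all invariant metrics on $G$.
   Context: Abelian groups are written additively. An abelian group $G$ is unbounded if it either contains an element of infinite order or contains elements of arbitrarily high finite orders. A metric $d$ on an abelian group $G$ is invariant if $d(a,b)=d(a+c,b+c)$ for all $a,b,c\in G$. The space of all invariant metrics on a countable group $G$ is a subset of $\mathbb{R}^{G\times G}$ and carries the subspace topology of the product topology (pointwise convergence), with which it is a Polish space. The Urysohn space $\mathbb{U}$ is the unique (up to isometry) complete separable metric space which contains an isometric copy of every separable metric space and in which every partial isometry between two finite subsets extends to an autoisometry of the whole space. The rational Urysohn space $\mathbb{Q}\mathbb{U}$ is the unique (up to isometry) countable metric space with rational distances which contains an isometric copy of every finite metric space with rational distances and in which every partial isometry between two finite subsets extends to an autoisometry of the whole space. *)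

(* Defs.v *)
From HB Require Import structures.
From mathcomp Require Import all_boot all_order all_algebra.
From mathcomp Require Import all_classical all_reals all_analysis.

Set Implicit Arguments.
Unset Strict Implicit.
Unset Printing Implicit Defensive.

Import Order.TTheory GRing.Theory Num.Theory.
Import numFieldNormedType.Exports.

Local Open Scope classical_set_scope.
Local Open Scope ring_scope.

Section MetricSpaces.
Variable R : realType.
Implicit Types X Y U : metricType R.

Definition isometry X Y (f : X -> Y) : Prop :=
  forall x y, mdist (f x) (f y) = mdist x y.

Definition isometric X Y : Prop :=
  exists2 f : X -> Y, bijective f & isometry f.

Definition autoisometry X (g : X -> X) : Prop := bijective g /\ isometry g.

Definition contains_copy_of U X : Prop := exists f : X -> U, isometry f.

(* [f] matters only on [A]. *)
Definition partial_isometry X (A B : set X) (f : X -> X) : Prop :=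
  set_bij A B f /\
  forall x y, A x -> A y -> mdist (f x) (f y) = mdist x y.

Definition ultrahomogeneous U : Prop :=
  forall (A B : set U) (f : U -> U),
    finite_set A -> finite_set B -> partial_isometry A B f ->
    exists2 g : U -> U, autoisometry g & forall x, A x -> g x = f x.

Definition separable X : Prop :=
  exists2 D : set X, countable D & dense D.

(* The library's [completeType] asks for a distinguished point in addition. *)
Definition complete_space X : Prop :=
  forall F : set_system X, ProperFilter F -> cauchy F -> exists x : X, F --> x.

Definition rational_distances X : Prop :=
  forall x y : X, exists q : rat, mdist x y = ratr q.

Definition is_completion X Y : Prop :=
  complete_space Y /\
  exists2 i : X -> Y, isometry i & dense (range i).

Definition is_Urysohn U : Prop :=
  [/\ complete_space U,
      separable U,
      forall X : metricType R, separable X -> contains_copy_of U X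
    & ultrahomogeneous U].

Definition is_rational_Urysohn U : Prop :=
  [/\ countable [set: U],
      rational_distances U,
      forall X : metricType R,
        finite_set [set: X] -> rational_distances X -> contains_copy_of U X
    & ultrahomogeneous U].

(* The two Urysohn spaces are determined up to isometry by their defining
   properties, so being isometric to "the" space is being isometric to some
   space with these properties; likewise for the completion. *)
Definition isometric_to_rational_Urysohn X : Prop :=
  exists2 QU : metricType R, is_rational_Urysohn QU & isometric X QU.

Definition completion_isometric_to_Urysohn X : Prop :=
  exists2 Y : metricType R, is_completion X Y &
    exists2 U : metricType R, is_Urysohn U & isometric Y U.

End MetricSpaces.

Definition element_has_order (G : zmodType) (g : G) (n : nat) : Prop :=
  [/\ (0 < n)%N, g *+ n = 0 &
      forall m : nat, (0 < m < n)%N -> g *+ m <> 0].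

Definition unbounded_group (G : zmodType) : Prop :=
  (exists g : G, forall n : nat, (0 < n)%N -> g *+ n <> 0) \/
  (forall N : nat, exists (g : G) (n : nat),
     (N <= n)%N /\ element_has_order g n).

Record is_invariant_metric (R : realType) (G : zmodType)
    (d : G * G -> R) : Prop := IsInvariantMetric {
  invm_refl : forall a, d (a, a) = 0;
  invm_sep : forall a b, d (a, b) = 0 -> a = b;
  invm_sym : forall a b, d (a, b) = d (b, a);
  invm_triangle : forall b a c, d (a, c) <= d (a, b) + d (b, c);
  invm_invariant : forall a b c, d (a, b) = d (a + c, b + c) }.

(* As a type, this is a [set_type] and carries the subspace topology of the
   topology of pointwise convergence. *)
Definition invariant_metrics (R : realType) (G : zmodType) :
  set {ptws (G * G) -> R} := [set d | is_invariant_metric d].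
Arguments invariant_metrics : clear implicits.

(* A copy of [G] indexed by [d], so that [d] can be its canonical metric. *)
Definition metrized (R : realType) (G : zmodType)
  (d : invariant_metrics R G) : Type := G.

Section MetrizedMetric.
Variables (R : realType) (G : zmodType) (d : invariant_metrics R G).

Definition metrized_dist (a b : metrized d) : R := set_val d (a : G, b : G).

Let metrizedP : is_invariant_metric (set_val d).
Proof. exact: set_valP d. Qed.

HB.instance Definition _ := Choice.copy (metrized d) G.

HB.instance Definition _ := @isMetric.Build R (metrized d) metrized_dist
  (invm_refl metrizedP) (invm_sep metrizedP) (invm_sym metrizedP)
  (invm_triangle metrizedP).

End MetrizedMetric.

(* Main.v *)
Require Import Defs.
From HB Require Import structures.
From mathcomp Require Import all_boot all_order all_algebra.
From mathcomp Require Import all_classical all_reals all_analysis borel_hierarchy.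
From mathcomp Require Import lra.

Set Implicit Arguments.
Unset Strict Implicit.
Unset Printing Implicit Defensive.

Import Order.TTheory GRing.Theory Num.Theory.
Import numFieldNormedType.Exports.

Local Open Scope classical_set_scope.
Local Open Scope ring_scope.

(** An invariant metric on [G] is [d(a, b) = lam (a - b)] for a length function
    [lam], and both Urysohn spaces are characterized by one-point extensions:
    for finitely many points [a_i] and values [f_i] satisfying the triangle
    inequalities [|f_i - f_j| <= d(a_i, a_j) <= f_i + f_j] (a Katetov function),
    some point lies at distance [f_i] from every [a_i].  With rational distances
    and rational values this property makes a countable space isometric to the
    rational Urysohn space ([rational_Urysohn_criterion]); with real values it
    makes a complete separable space isometric to the Urysohn space
    ([Urysohn_criterion]).  Both facts are back-and-forth arguments.

    Density.  Near a given length function there is a rational one with the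
    rational extension property.  It is built from finite amounts of data: a
    finite list of weighted group elements is consistent ([good]) when no word
    in these elements undercuts a prescribed weight, so that it is the
    restriction of the cheapest-word length.  Rounding the given length up on
    finitely many elements gives a first list ([good_approximation]).  A list can
    be enlarged so as to contain any further element ([good_cover]) and, when [G]
    is unbounded, so as to solve any extension problem ([good_extend]): the new
    point is an element [g] none of whose small nonzero multiples is a short word
    in the old elements.  A word in the enlarged list then either treats [g] as a
    free variable, and the triangle inequalities apply, or is so long that it is
    expensive.  Carrying out all countably many tasks one after the other gives
    the length function ([universal_length_extension]).

    The G-delta set.  The completion of [(G, d)] is the Urysohn space if and only
    if extension problems in [G] with rational data that are consistent up to
    [e] have solutions in [G] up to [2 e] ([completion_isometric_to_UrysohnP]).
    In a complete space approximate solutions can be improved to exact ones along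
    a Cauchy sequence ([approximate_extension_exact]); conversely an approximately
    consistent problem is close to a consistent one ([approximate_extension]).
    For fixed data the condition is open in [d]: to be inconsistent and to have
    an approximate solution are both strict inequalities between finitely many
    distances ([nearly_solved_open]).  There are countably many data.  A rational
    length with the rational extension property satisfies all these conditions,
    so that the first dense set is contained in the second. *)

(** * Finite sequences and countable constructions *)

Lemma seq_argmin (K : realDomainType) (T : eqType) (F : T -> K) (s : seq T) :
  s != [::] -> exists2 m, m \in s & forall x, x \in s -> F m <= F x.
Proof.
elim: s => // a s IH _; have [->|/IH [m ms mP]] := eqVneq s [::].
  by exists a; rewrite ?mem_seq1// => x; rewrite mem_seq1 => /eqP ->.
have [Fam|/ltW Fma] := lerP (F a) (F m).
  exists a; rewrite ?mem_head// => x; rewrite in_cons => /predU1P[->//|/mP].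
  exact: le_trans.
exists m; rewrite ?in_cons ?ms ?orbT// => x /[!in_cons] /predU1P[->//|].
exact: mP.
Qed.

Lemma seq_pos_lower_bound (K : realDomainType) (T : eqType) (F : T -> K)
    (s : seq T) :
  (forall x, x \in s -> 0 < F x) ->
  exists2 c, 0 < c & forall x, x \in s -> c <= F x.
Proof.
move=> sP; have [->|/(seq_argmin F) [m ms mP]] := eqVneq s [::].
  by exists 1.
by exists (F m) => //; exact: sP.
Qed.

Lemma seq_upper_bound (K : realDomainType) (T : eqType) (F : T -> K)
    (s : seq T) :
  exists2 c, 0 < c & forall x, x \in s -> F x <= c.
Proof.
have [->|/(seq_argmin (fun x => - F x)) [m ms mP]] := eqVneq s [::].
  by exists 1.
exists (Num.max 1 (F m)) => [|x /mP]; first by rewrite lt_max ltr01.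
by rewrite lerN2 => Fxm; rewrite le_max Fxm orbT.
Qed.

Lemma countable_index (T : Type) (D : set T) :
  countable D -> exists f : T -> nat, {in D &, injective f}.
Proof. by case/countable_injP => f fP; exists f. Qed.

Lemma countable_seq (T : choiceType) (C : countType) :
  countable [set: T] -> countable [set: seq (T * C)].
Proof.
case/countable_index => f finj; apply/countable_injP.
exists (fun s => pickle [seq (f p.1, p.2) | p <- s]) => s t _ _.
move/(pcan_inj pickleK); apply: inj_map => -[a b] [c d] /= [fac ->].
by congr (_, _); apply: finj; rewrite ?inE.
Qed.

Lemma near_all (T : Type) (F : set_system T) (I : eqType) (s : seq I)
    (P : I -> T -> Prop) : Filter F ->
  (forall i, i \in s -> \forall x \near F, P i x) ->
  \forall x \near F, forall i, i \in s -> P i x.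
Proof.
move=> FF; elim: s => [_|i s IH h]; first by apply: nearW => x i; rewrite in_nil.
have hi := h i (mem_head _ _).
have hs : \forall x \near F, forall j, j \in s -> P j x.
  by apply: IH => j js; apply: h; rewrite in_cons js orbT.
by apply: filterS2 hi hs => x Pi Ps j /[!in_cons] /predU1P[->//|/Ps].
Qed.

(** Dependent choice with a countable list of tasks: an invariant of finite
    lists under which every task can be carried out by enlarging the list
    yields a directed union in which all tasks are done. *)
Lemma directed_union (Z : eqType) (T : Type) (D : set T)
    (inv : seq Z -> Prop) (achieved : T -> seq Z -> Prop) (s0 : seq Z) :
  countable D -> inv s0 ->
  (forall s t, inv s -> D t ->
     exists s', [/\ inv s', {subset s <= s'} & achieved t s']) ->
  exists W : set Z,
    (forall l : seq Z, (forall z, z \in l -> W z) ->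
       exists s, [/\ inv s, {subset s0 <= s}, {subset l <= s} &
                     forall z, z \in s -> W z]) /\
    (forall t, D t ->
       exists s, [/\ inv s, achieved t s & forall z, z \in s -> W z]).
Proof.
case/countable_index => f finj inv0 step.
pose Q n (s s' : seq Z) := inv s ->
  [/\ inv s', {subset s <= s'} & forall t, D t -> f t = n -> achieved t s'].
have /choice [next nextP] : forall ns : nat * seq Z, exists s', Q ns.1 ns.2 s'.
  move=> [n s]; rewrite /Q /=.
  have [is_|//] := pselect (inv s); last by exists s.
  have [[t [Dt ft]]|nt] := pselect (exists t, D t /\ f t = n).
    have [s' [is' ss' dt]] := step _ _ is_ Dt; exists s' => _; split=> // t' Dt' ft'.
    by rewrite (finj t' t) ?inE// ft ft'.
  by exists s => _; split=> // t Dt ft; case: nt; exists t.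
pose u := fix u n := if n is m.+1 then next (m, u m) else s0.
have uinv n : inv (u n).
  by elim: n => //= n IH; have [] := nextP (n, u n) IH.
have uS m n : (m <= n)%N -> {subset u m <= u n}.
  move=> /subnK <-; elim: (n - m)%N => //= k IH z /IH.
  by have [_ /(_ z)] := nextP ((k + m)%N, u (k + m)%N) (uinv _).
exists [set z | exists n, z \in u n]; split => [l lW|t Dt]; last first.
  have [_ _ /(_ t Dt erefl) dt] := nextP (f t, u (f t)) (uinv _).
  by exists (u (f t).+1); split=> // z zu; exists (f t).+1.
suff [n ln] : exists n, {subset l <= u n}.
  by exists (u n); split=> //; [exact: (uS 0%N)|move=> z zn; exists n].
elim: l lW => [|z l IH] lW; first by exists 0%N.
have [m zm] := lW z (mem_head _ _).
have [|n ln] := IH; first by move=> y yl; apply: lW; rewrite in_cons yl orbT.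
exists (maxn m n) => y /[!in_cons] /predU1P[->|/ln].
  by apply: uS zm; rewrite leq_maxl.
by apply: uS; rewrite leq_maxr.
Qed.

(** * Weighted words in an abelian group *)

Section Words.
Variable G : zmodType.
Implicit Types (W : seq (G * rat)) (x y : G) (c w : rat).

Definition letter W y w := (y, w) \in W \/ (- y, w) \in W.

Inductive word W : nat -> G -> rat -> Prop :=
| word_nil : word W 0 0 0
| word_cons n x c y w :
    word W n x c -> letter W y w -> word W n.+1 (x + y) (c + w).

(** These are the weights that the cheapest-word length extends; as that length
    need not be finite everywhere, only the finite data are kept. *)
Definition good W := forall y w, (y, w) \in W ->
  0 < w /\ forall n c, word W n y c -> w <= c.

(** A good weight does not mention 0, as the empty word costs nothing. *)
Definition len W x w := (x = 0 /\ w = 0) \/ letter W x w.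

Lemma letterN W y w : letter W y w -> letter W (- y) w.
Proof. by rewrite /letter opprK; case; [right|left]. Qed.

Lemma lenN W x w : len W x w -> len W (- x) w.
Proof.
by case=> [[-> ->]|/letterN]; [left; rewrite oppr0|right].
Qed.

Lemma wordN W n x c : word W n x c -> word W n (- x) c.
Proof.
elim=> [|{}n {}x {}c y w _ IH /letterN yw]; first by rewrite oppr0; constructor.
by rewrite opprD; constructor.
Qed.

Lemma word_add W n m x y c d :
  word W n x c -> word W m y d -> word W (n + m) (x + y) (c + d).
Proof.
move=> xc; elim=> [|{}m {}y {}d z w _ IH zw]; first by rewrite addn0 !addr0.
by rewrite addnS !addrA; constructor.
Qed.

Lemma letter_word W y w : letter W y w -> word W 1 y w.
Proof.
by move=> yw; rewrite -(add0r y) -(add0r w); constructor=> //; constructor.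
Qed.

Lemma sub_letter W W' y w : {subset W <= W'} -> letter W y w -> letter W' y w.
Proof. by move=> WW' [] /WW'; [left|right]. Qed.

Lemma sub_len W W' y w : {subset W <= W'} -> len W y w -> len W' y w.
Proof. by move=> WW' [|/(sub_letter WW')]; [left|right]. Qed.

Lemma sub_word W W' n y c : {subset W <= W'} -> word W n y c -> word W' n y c.
Proof.
by move=> WW'; elim=> [|*]; constructor=> //; exact: sub_letter WW' _.
Qed.

Lemma word_ge W c0 n x c : (forall p, p \in W -> c0 <= p.2) ->
  word W n x c -> c0 *+ n <= c.
Proof.
move=> Wc0; elim=> // {}n {}x {}c y w _ IH yw; rewrite mulrSr lerD//.
by case: yw => /Wc0.
Qed.

Lemma good_pos W p : good W -> p \in W -> 0 < p.2.
Proof. by case: p => y w gW /gW []. Qed.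

Lemma good_letter W y w n c : good W -> letter W y w -> word W n y c -> w <= c.
Proof.
move=> gW [/gW [_]|/gW [_ h]]; first exact.
by move=> /wordN; exact: h.
Qed.

Lemma word_ge0 W n x c : good W -> word W n x c -> 0 <= c.
Proof.
move=> gW /(@word_ge _ 0); rewrite mul0rn; apply=> p /(good_pos gW).
exact: ltW.
Qed.

Lemma good_len W x w n c : good W -> len W x w -> word W n x c -> w <= c.
Proof.
move=> gW [[_ ->]|]; [exact: word_ge0|exact: good_letter].
Qed.

Lemma len_word W x w : len W x w -> exists2 n, (n <= 1)%N & word W n x w.
Proof.
move=> [[-> ->]|/letter_word]; first by exists 0%N => //; constructor.
by exists 1%N.
Qed.

Lemma good_len_uniq W x w w' : good W -> len W x w -> len W x w' -> w = w'.
Proof.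
move=> gW xw xw'; have [n _ wn] := len_word xw; have [n' _ wn'] := len_word xw'.
by apply/eqP; rewrite eq_le (good_len gW xw wn') (good_len gW xw' wn).
Qed.

Lemma finite_words W N : exists l : seq (G * rat), forall n x c,
  (n <= N)%N -> word W n x c -> (x, c) \in l.
Proof.
elim: N => [|N [l lP]].
  exists [:: (0, 0)] => n x c n0 wd.
  by case: wd n0 => //; rewrite mem_head.
pose W2 := W ++ [seq (- p.1, p.2) | p <- W].
exists ((0, 0) :: [seq (p.1 + q.1, p.2 + q.2) | p <- l, q <- W2]) => n x c nN wd.
move: wd nN; case=> [|{}n {}x {}c y w wd yw nN]; first by rewrite mem_head.
rewrite in_cons; apply/orP; right; apply/allpairsP; exists ((x, c), (y, w)).
split=> //=; first exact: lP wd.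
rewrite mem_cat; case: yw => yw; first by rewrite yw.
by apply/orP; right; apply/mapP; exists (- y, w); rewrite // opprK.
Qed.

Lemma long_words_costly c0 C : 0 < c0 -> exists N, forall W n x c,
  (forall p, p \in W -> c0 <= p.2) -> (N < n)%N -> word W n x c -> C <= c.
Proof.
move=> c00; exists (Num.Def.truncn (C / c0)) => W n x c Wc0 Nn /(word_ge Wc0).
apply: le_trans; rewrite -mulr_natr mulrC -ler_pdivrMr//.
by apply/ltW/(lt_le_trans (truncnS_gt _)); rewrite ler_nat.
Qed.

(** Prescribing one more value: the cheapest word evaluating to [x], cut off
    at a bound [C] of all weights, can be taken as the weight of [x]. *)
Lemma good_cover W x : good W -> exists W',
  [/\ good W', {subset W <= W'} & exists w, len W' x w].
Proof.
move=> gW; have [->|x0] := eqVneq x 0.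
  by exists W; split=> //; exists 0; left.
have [C C0 WC] := seq_upper_bound (fun p : G * rat => p.2) W.
have [c0 c00 Wc0] := seq_pos_lower_bound (F := fun p : G * rat => p.2) (s := W)
  (fun p => @good_pos W p gW).
have [N NP] := long_words_costly C c00.
have [l lP] := finite_words W N.
(* The list [l] may contain pairs that are not words; the filter removes them. *)
pose costs := C :: [seq p.2 | p <- l & (p.1 == x) && `[< exists n, word W n p.1 p.2 >]].
have [w wcosts wmin] : exists2 w, w \in costs & forall c, c \in costs -> w <= c.
  exact: (seq_argmin id).
have wC : w <= C by apply: wmin; rewrite mem_head.
have wle n c : word W n x c -> w <= c.
  move=> wd; have [nN|Nn] := leqP n N; last exact: le_trans wC (NP _ _ _ _ Wc0 Nn wd).
  apply: wmin; rewrite in_cons; apply/orP; right; apply/mapP; exists (x, c) => //.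
  by rewrite mem_filter eqxx (lP _ _ _ nN wd) andbT/=; apply/asboolP; exists n.
have wP : w = C \/ exists n, word W n x w.
  move: wcosts; rewrite in_cons => /predU1P[|/mapP [[y c]]]; first by left.
  by rewrite mem_filter => /andP[/andP[/= /eqP -> /asboolP ? _] ->]; right.
have w0 : 0 < w.
  case: wP => [->//|[n wd]]; apply: (@lt_le_trans _ _ (c0 *+ n)); last first.
    exact: word_ge Wc0 wd.
  by case: wd x0 => [|k *]; rewrite ?eqxx// pmulrn_rgt0.
exists ((x, w) :: W); split; last by exists w; right; left; rewrite mem_head.
  (* If [w = C], a word that uses the new letter costs at least [C], which bounds
     all weights; otherwise the new letter abbreviates an old word of its cost. *)
  case: wP => [wC'|[m wdx]].
    have cheap n y c : word ((x, w) :: W) n y c -> word W n y c \/ C <= c.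
      elim=> [|{}n {}y {}c z v wd IH zv]; first by left; constructor.
      have c0' : 0 <= c.
        have := @word_ge ((x, w) :: W) 0 n y c; rewrite mul0rn; apply=> //.
        by move=> p /[!in_cons] /predU1P[->/=|/(good_pos gW)/ltW//]; rewrite ltW.
      have [zW|zx] : letter W z v \/ v = w.
        move: zv; rewrite /letter !in_cons => -[]/predU1P[[_ ->]|h];
          by [right|left; left|right|left; right].
      - case: IH => [IH|Cc]; first by left; constructor.
        by right; rewrite (le_trans Cc)// lerDl; case: zW => /(good_pos gW)/ltW.
      - by right; rewrite zx wC' lerDr.
    move=> y v /[!in_cons] /predU1P[[-> ->]|yW].
      by split=> // n c /cheap [/wle//|]; rewrite wC'.
    have [v0 vP] := gW _ _ yW; split=> // n c /cheap[/vP//|].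
    by apply: le_trans; exact: (WC _ yW).
  have replace n y c : word ((x, w) :: W) n y c -> exists k, word W k y c.
    elim=> [|{}n {}y {}c z v _ [k IH] zv]; first by exists 0%N; constructor.
    have [j wz] : exists j, word W j z v.
      move: zv; rewrite /letter !in_cons => -[]/predU1P[[ez ->]|h].
      - by exists m; rewrite ez.
      - by exists 1%N; apply: letter_word; left.
      - by exists m; rewrite -(opprK z) ez; exact: wordN.
      - by exists 1%N; apply: letter_word; right.
    by exists (k + j)%N; exact: word_add.
  move=> y v /[!in_cons] /predU1P[[-> ->]|yW].
    by split=> // n c /replace [k /wle].
  by have [v0 vP] := gW _ _ yW; split=> // n c /replace [k /vP].
by move=> p pW; rewrite in_cons pW orbT.
Qed.


Lemma unbounded_multiples : unbounded_group G ->
  forall B, exists g : G, forall m, (0 < m <= B)%N -> g *+ m != 0.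
Proof.
move=> [[g gP]|h] B; first by exists g => m /andP[m0 _]; exact/eqP/gP.
have [g [n [Bn [_ _ gP]]]] := h B.+1; exists g => m /andP[m0 mB].
by apply/eqP/gP; rewrite m0 (leq_ltn_trans mB).
Qed.

(** Among the multiples [g0, 2 g0, .., L g0] of an element of huge order, each
    equation [(j k) g0 = s] has at most one solution [j]; so for [L] large some
    [j g0] has all its small multiples outside of [S]. *)
Lemma unbounded_avoid : unbounded_group G ->
  forall (S : seq G) N, exists g : G, forall m, (0 < m <= N)%N -> g *+ m \notin S.
Proof.
move=> hG S N; pose L := (N * size S).+1.
have [g0 g0P] := unbounded_multiples hG (L * N).
apply: contrapT => /forallNP nog.
have /choice [k kP] : forall j : 'I_L, exists k : 'I_N, g0 *+ (j.+1 * k.+1) \in S.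
  move=> j; apply: contrapT => /forallNP nok; apply: (nog (g0 *+ j.+1)) => m.
  case: m => // m /= mN; rewrite -mulrnA; apply/negP => jm.
  exact: (nok (Ordinal mN)).
(* If every [j g0] fails, recording the failure is injective in [j]. *)
pose phi (j : 'I_L) := (k j, g0 *+ (j.+1 * (k j).+1)).
have phi_inj : injective phi.
  have lt_phi (i j : 'I_L) : (i < j)%N -> phi i <> phi j.
    move=> ij [kij]; rewrite -kij => /eqP; rewrite eq_sym -subr_eq0.
    rewrite -mulrnBr; last by rewrite leq_mul// ltnS ltnW.
    rewrite -mulnBl subSS; apply/negP/g0P.
    rewrite muln_gt0 subn_gt0 ij/= leq_mul// (leq_trans (leq_subr _ _))//.
    exact: ltnW.
  move=> i j eij; apply/val_inj; have [/lt_phi|/lt_phi|//] := ltngtP i j.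
    by case/(_ eij).
  by case/(_ (esym eij)).
suff : (size (enum 'I_L) <= N * size S)%N by rewrite size_enum_ord ltnn.
rewrite -(size_map phi).
have -> : (N * size S)%N = size [seq (i, x) | i <- enum 'I_N, x <- S].
  by rewrite size_allpairs size_enum_ord.
apply: uniq_leq_size; first by rewrite map_inj_uniq ?enum_uniq.
by move=> _ /mapP[j _ ->]; rewrite allpairs_f// mem_enum.
Qed.

(** The new point [g] is at distance [p.2] from each [p.1].  A word in the
    enlarged weight collects into an old word and a sum of terms [g - p.1] of
    one sign, because [(g - p.1) - (g - q.1)] can be replaced by the cheaper
    old [q.1 - p.1].  If the word is short, the multiple of [g] that it
    contains must be the evident one, as [g] has no small multiples among
    short words; if it is long, it costs more than every weight. *)
Lemma good_extend W (A : seq (G * rat)) : unbounded_group G -> good W ->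
  (forall p, p \in A -> 0 < p.2) ->
  (forall p q, p \in A -> q \in A -> exists w,
     [/\ len W (p.1 - q.1) w, p.2 <= q.2 + w & w <= p.2 + q.2]) ->
  exists W' g, [/\ good W', {subset W <= W'} &
                   forall p, p \in A -> letter W' (g - p.1) p.2].
Proof.
move=> hG gW A0 kA.
have solve (x k s z : G) : z = x + (k - s) -> k = - x + s + z.
  by move=> ->; rewrite addrAC addKr subrK.
pose Wc := W ++ A.
have Wc0 p : p \in Wc -> 0 < p.2.
  by rewrite mem_cat => /orP[/(good_pos gW)|/A0].
have [C C0 WC] := seq_upper_bound (fun p : G * rat => p.2) Wc.
have [c0 c00 Wcc0] := seq_pos_lower_bound (F := fun p : G * rat => p.2) Wc0.
have [N NP] := long_words_costly C c00.
pose W2 := W ++ [seq (p.1, 0) | p <- A].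
have [l lP] := finite_words W2 N.+1.
have [g gP] := unbounded_avoid hG [seq p.1 | p <- l] N.+1.
have gN m n x c : (0 < m <= N.+1)%N -> (n <= N.+1)%N -> word W2 n x c ->
    g *+ m <> x.
  move=> mN nN /(lP _ _ _ nN) xl gx; move/negP: (gP _ mN); apply.
  by rewrite gx; apply/mapP; exists (x, c).
have sumA t : {subset t <= A} -> word W2 (size t) (\sum_(p <- t) p.1) 0.
  elim: t => [_|p t IH tA]; first by rewrite big_nil; constructor.
  rewrite big_cons addrC -[X in word _ _ _ X](addr0 0); constructor.
    by apply: IH => q qt; apply: tA; rewrite in_cons qt orbT.
  left; rewrite mem_cat; apply/orP; right; apply/mapP; exists p => //.
  exact/tA/mem_head.
have sumW n x c : word W n x c -> word W2 n x c.
  by apply: sub_word => p pW; rewrite mem_cat pW.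
have letA p : p \in A -> letter W2 p.1 0.
  by move=> pA; left; rewrite mem_cat (map_f (fun p => (p.1, 0)))// orbT.
(* The normal form of words in the enlarged weight: an old word plus a sum of
   terms [g - p.1], all of the same sign. *)
pose Dp n y c := exists t x' c' n', [/\ {subset t <= A}, word W n' x' c',
  (n' + size t <= n)%N, y = x' + (g *+ size t - \sum_(p <- t) p.1) &
  c' + \sum_(p <- t) p.2 <= c].
pose D n y c := Dp n y c \/ Dp n (- y) c.
have DN n y c : D n y c -> D n (- y) c.
  by rewrite /D opprK; case; [right|left].
have DpW n y c z w : Dp n y c -> letter W z w -> Dp n.+1 (y + z) (c + w).
  move=> [t [x' [c' [n' [tA wx nt -> cc]]]]] zw.
  exists t, (x' + z), (c' + w), n'.+1; split=> //; first by constructor.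
    by rewrite addrAC.
  by rewrite addrAC lerD.
have DW n y c z w : D n y c -> letter W z w -> D n.+1 (y + z) (c + w).
  move=> [Dy|Dy] zw; [left; exact: DpW|right].
  by rewrite opprD; apply: DpW => //; exact: letterN.
have Dg n y c p : D n y c -> p \in A -> D n.+1 (y + (g - p.1)) (c + p.2).
  move=> [|] [t [x' [c' [n' [tA wx nt ey cc]]]]] pA.
    left; exists (p :: t), x', c', n'; split=> //=.
    - by move=> q /[!in_cons] /predU1P[->//|/tA].
    - by rewrite addnS ltnS.
    - by rewrite ey big_cons mulrSr -addrA (addrC p.1) opprD addrACA.
    - by rewrite big_cons addrCA addrC lerD.
  (* A term [g - p.1] meets negative terms: it cancels one of them, and the old
     element [p.1 - q.1] that remains is no more expensive than the pair. *)
  case: t tA nt ey cc => [|q t] tA nt ey cc.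
    left; exists [:: p], (- x'), c', n'; split=> //=.
    - by move=> q; rewrite mem_seq1 => /eqP ->.
    - exact: wordN.
    - by rewrite addn1 ltnS; rewrite addn0 in nt.
    - by rewrite big_seq1 -[y]opprK ey /= mulr0n big_nil subrr addr0.
    - by rewrite big_seq1; rewrite big_nil addr0 in cc; rewrite lerD.
  have [w [lw _ wpq]] := kA p q pA (tA _ (mem_head _ _)).
  have [m m1 wm] := len_word lw.
  right; exists t, (x' + (p.1 - q.1)), (c' + w), (n' + m)%N; split.
  - by move=> r rt; apply: tA; rewrite in_cons rt orbT.
  - exact: word_add.
  - rewrite (addnAC n') ltnW// ltnS addnC (leq_trans (leq_add m1 (leqnn _)))//.
    by rewrite add1n -addnS.
  - rewrite opprD ey /= big_cons mulrSr -!addrA; congr (_ + _).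
    rewrite !addrA opprB addrC opprD (addrC (g *+ _)) !addrA subrK -!addrA.
    by congr (_ + _); rewrite addrCA.
  - move: cc; rewrite big_cons; move: wpq; set s := \sum_(j <- t) _; lra.
pose W' := W ++ [seq (g - p.1, p.2) | p <- A].
have W'P y w : letter W' y w -> letter W y w \/
    exists2 p, p \in A & w = p.2 /\ (y = g - p.1 \/ y = - (g - p.1)).
  rewrite /letter !mem_cat => -[]/orP[h|/mapP[p pA [e ->]]];
    [by left; left|right|by left; right|right]; exists p => //; split=> //.
    by left.
  by right; rewrite -e opprK.
have wordD n y c : word W' n y c -> D n y c.
  elim=> [|{}n {}y {}c z w _ Dy /W'P[zw|[p pA [-> [->|->]]]]].
  - left; exists [::], 0, 0, 0%N; split=> //; first by constructor.
      by rewrite mulr0n big_nil subrr addr0.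
    by rewrite big_nil addr0.
  - exact: DW.
  - exact: Dg.
  - by rewrite -[y in y - _]opprK -opprD; apply/DN/Dg => //; exact: DN.
have W'c0 p : p \in W' -> c0 <= p.2.
  rewrite mem_cat => /orP[pW|/mapP[q qA ->]].
    by apply: Wcc0; rewrite mem_cat pW.
  by apply: (Wcc0 q); rewrite mem_cat qA orbT.
have W'C p : p \in W' -> p.2 <= C.
  rewrite mem_cat => /orP[pW|/mapP[q qA ->]].
    by apply: WC; rewrite mem_cat pW.
  by apply: (WC q); rewrite mem_cat qA orbT.
exists W', g; split; last 2 first.
- by move=> p pW; rewrite mem_cat pW.
- by move=> p pA; left; rewrite mem_cat (map_f (fun p => (g - p.1, p.2)))// orbT.
move=> y w yw; split; first exact: lt_le_trans c00 (W'c0 _ yw).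
move=> n c wd; have [nN|Nn] := leqP n N; last first.
  exact: le_trans (W'C _ yw) (NP _ _ _ _ W'c0 Nn wd).
(* From now on the word is short, so a nonzero multiple of [g] in an equation
   between old elements contradicts the choice of [g]. *)
have sumt t n' x c' : (n' + size t <= n)%N -> {subset t <= A} -> word W n' x c' ->
    exists2 m, (m <= N)%N & word W2 m (x + \sum_(p <- t) p.1) (c' + 0).
  move=> nt tA wx; exists (n' + size t)%N; first exact: leq_trans nt nN.
  by apply: word_add; [exact: sumW|exact: sumA].
have tpos (t : seq (G * rat)) : {subset t <= A} -> 0 <= \sum_(p <- t) p.2.
  by move=> tA; rewrite big_seq sumr_ge0// => p /tA/A0/ltW.
have tN n' (t : seq (G * rat)) : (n' + size t <= n)%N -> (size t <= N)%N.
  by move=> h; apply: leq_trans (leq_trans (leq_addl _ _) h) nN.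
move: yw; rewrite mem_cat => /orP[yW|/mapP[p pA [ey ->]]].
  have [_ yP] := gW _ _ yW.
  have key (t : seq (G * rat)) x' c' n' z : {subset t <= A} -> word W n' x' c' ->
      (n' + size t <= n)%N -> letter W z w ->
      z = x' + (g *+ size t - \sum_(p <- t) p.1) ->
      c' + \sum_(p <- t) p.2 <= c -> w <= c.
    case: t => [|q t] tA wx nt zw ez cc.
      move: ez cc; rewrite /= mulr0n !big_nil subrr !addr0 => ez; apply: le_trans.
      by rewrite ez in zw; exact: good_letter wx.
    have [m mN] := sumt _ _ _ _ nt tA (wordN wx).
    move/word_cons/(_ (sub_letter (W' := W2) _ zw)) => wm.
    exfalso; apply: (gN (size (q :: t)) _ _ _ _ _ (wm _)) => //.
    - by apply/andP; split=> //; apply: leqW; exact: tN nt.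
    - by move=> r rW; rewrite mem_cat rW.
    - exact: solve ez.
  case: (wordD _ _ _ wd) => -[t [x' [c' [n' [tA wx nt ez cc]]]]].
    by apply: (key t x' c' n' y) => //; left.
  by apply: (key t x' c' n' (- y)) => //; right; rewrite opprK.
case: (wordD _ _ _ wd) => -[t [x' [c' [n' [tA wx nt ez cc]]]]]; last first.
  have [m mN] := sumt _ _ _ _ nt tA (wordN wx).
  move/word_cons/(_ (letA _ pA)) => wm.
  exfalso; apply: (gN (size t).+1 _ _ _ _ _ wm) => //.
    by rewrite ltnS; exact: tN nt.
  by rewrite mulrSr (solve _ _ _ _ ez) ey opprB -[LHS]addrA subrK.
move: ez cc nt tA; case: t => [|q [|r t]] ez cc nt tA.
- exfalso; move: ez; rewrite /= mulr0n big_nil subrr addr0 ey => ez.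
  apply: (gN 1%N n'.+1 (x' + p.1) (c' + 0)) => //.
  + by rewrite ltnS (leq_trans _ nN)// (leq_trans _ nt)// leq_addr.
  + by constructor; [exact: sumW|exact: letA].
  + by rewrite mulr1n -ez subrK.
- (* A single term [g - q.1]: the triangle inequality for [p] and [q]. *)
  move: ez cc; rewrite ey /= mulr1n !big_seq1 => ez cc.
  have [v [lv pqv _]] := kA p q pA (tA _ (mem_head _ _)).
  suff ex' : - (p.1 - q.1) = x'.
    apply: le_trans cc; apply: le_trans pqv _; rewrite addrC lerD2r.
    by apply: good_len gW (lenN lv) _; rewrite ex'; exact: wx.
  by apply: (addIr (g - q.1)); rewrite -ez opprB addrC subrKA.
- exfalso; have [m mN] := sumt _ _ _ _ nt tA (wordN wx).
  move/word_cons/(_ (letterN (letA _ pA))) => wm.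
  apply: (gN (size (r :: t)) _ _ _ _ _ wm) => //.
    by rewrite /= leqW// (leq_trans _ (tN _ _ nt)).
  apply: (addIr g); rewrite -mulrSr (solve _ _ _ _ ez) ey -[RHS]addrA.
  by rewrite (addrC (- p.1)).
Qed.

Lemma good_covers W (l : seq G) : good W -> exists W',
  [/\ good W', {subset W <= W'} & forall x, x \in l -> exists w, len W' x w].
Proof.
move=> gW; elim: l => [|x l [W' [gW' WW' lW']]].
  by exists W; split=> // ?; rewrite in_nil.
have [V [gV W'V xV]] := good_cover x gW'; exists V; split=> //.
  by move=> p /WW'; exact: W'V.
move=> y /[!in_cons] /predU1P[->//|/lW' [w yw]].
by exists w; exact: sub_len yw.
Qed.

(** A length function, with the one-point extension property that makes the
    induced metric universal and homogeneous among rational ones. *)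
Definition universal_length (lam : G -> rat) :=
  [/\ forall x, lam x = 0 <-> x = 0,
      forall x, lam (- x) = lam x,
      forall x y, lam (x + y) <= lam x + lam y &
      forall A : seq (G * rat), (forall p, p \in A -> 0 < p.2) ->
        (forall p q, p \in A -> q \in A ->
           p.2 <= q.2 + lam (p.1 - q.1) /\ lam (p.1 - q.1) <= p.2 + q.2) ->
        exists g, forall p, p \in A -> lam (g - p.1) = p.2].

Theorem universal_length_extension W0 :
  countable [set: G] -> unbounded_group G -> good W0 ->
  exists2 lam, universal_length lam & forall p, p \in W0 -> lam p.1 = p.2.
Proof.
move=> cG hG gW0.
pose katetov_for W (A : seq (G * rat)) := forall p q, p \in A -> q \in A ->
  exists w, [/\ len W (p.1 - q.1) w, p.2 <= q.2 + w & w <= p.2 + q.2].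
pose achieved (A : seq (G * rat)) W :=
  (forall p q, p \in A -> q \in A -> exists w, len W (p.1 - q.1) w) /\
  ((forall p, p \in A -> 0 < p.2) -> katetov_for W A ->
     exists g, forall p, p \in A -> len W (g - p.1) p.2).
have step W A : good W -> [set: seq (G * rat)] A ->
    exists W', [/\ good W', {subset W <= W'} & achieved A W'].
  move=> gW _; have [V [gV WV cV]] :=
    good_covers [seq p.1 - q.1 | p <- A, q <- A] gW.
  have VA p q : p \in A -> q \in A -> exists w, len V (p.1 - q.1) w.
    by move=> pA qA; apply: cV; exact: (allpairs_f (fun p q => p.1 - q.1)).
  have [[A0 kA]|nkA] := pselect ((forall p, p \in A -> 0 < p.2) /\ katetov_for V A).
    have [U [g [gU VU gA]]] := good_extend hG gV A0 kA.
    exists U; split=> //; first by move=> p /WV/VU.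
    split=> [p q pA qA|_ _]; last by exists g => p pA; right; exact: gA.
    by have [w lw] := VA p q pA qA; exists w; exact: sub_len lw.
  by exists V; split=> //; split=> // A0 kA; case: nkA.
have [U [Ufin Udone]] := directed_union (countable_seq _ cG) gW0 step.
have mem2 (T : eqType) (x y : T) : y \in [:: x; y] by rewrite !inE eqxx orbT.
(* The prescribed lengths are read off at any stage that contains them; stages
   are directed and good, so that the values agree. *)
pose lenU x w := exists V, [/\ good V, forall z, z \in V -> U z & len V x w].
have /choice [lam lamP] : forall x, exists w, lenU x w.
  move=> x; have [V [gV [cV _] VU]] := Udone [:: (x, 1); (0, 1)] I.
  have [w] := cV (x, 1) (0, 1) (mem_head _ _) (mem2 _ _ _).
  by rewrite subr0 => lw; exists w, V.
have lamV (l : seq G) (L : seq (G * rat)) : (forall z, z \in L -> U z) ->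
    exists V, [/\ good V, {subset W0 <= V}, {subset L <= V} &
                  forall x, x \in l -> len V x (lam x)].
  elim: l L => [|x l IH] L LU.
    by have [V [gV W0V LV _]] := Ufin L LU; exists V.
  have [Vx [_ VxU lx]] := lamP x.
  have [|V [gV W0V LV lV]] := IH (Vx ++ L).
    by move=> z; rewrite mem_cat => /orP[/VxU|/LU].
  exists V; split=> // [z zL|y]; first by apply: LV; rewrite mem_cat zL orbT.
  rewrite in_cons => /predU1P[->|/lV//]; apply: sub_len lx => z zVx.
  by apply: LV; rewrite mem_cat zVx.
have lam_len V x w : good V -> (forall z, z \in V -> U z) -> len V x w -> lam x = w.
  move=> gV VU xw; have [V' [gV' _ VV' lV']] := lamV [:: x] V VU.
  by apply: (good_len_uniq gV' (lV' _ (mem_head _ _))); exact: sub_len xw.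
have nilU z : z \in [::] -> U z by rewrite in_nil.
exists lam; last first.
  move=> [x w] xw; have [V [gV W0V _ lV]] := lamV [:: x] [::] nilU.
  apply: (good_len_uniq gV (lV _ (mem_head _ _))); right; left; exact: W0V.
split.
- move=> x; have [V [gV _ _ lV]] := lamV [:: x; 0] [::] nilU.
  have [l0 l00] := (lV x (mem_head _ _), lV 0 (mem2 _ _ _)).
  split=> [lam0|->]; last by apply: (good_len_uniq gV l00); left.
  by case: l0 => [[]//|[]/(good_pos gV)]; rewrite lam0 ltxx.
- move=> x; have [V [gV _ _ lV]] := lamV [:: x; - x] [::] nilU.
  apply: (good_len_uniq gV (lV _ (mem2 _ _ _))).
  by apply/lenN/lV; rewrite mem_head.
- move=> x y; have [V [gV _ _ lV]] := lamV [:: x + y; x; y] [::] nilU.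
  have [|n _ wx] := len_word (lV x _); first by rewrite !inE eqxx orbT.
  have [|m _ wy] := len_word (lV y _); first by rewrite !inE eqxx !orbT.
  exact: good_len gV (lV _ (mem_head _ _)) (word_add wx wy).
- move=> A A0 kA; have [V [gV [cV xV] VU]] := Udone A I.
  have [p q pA qA|g gA] := xV A0; last first.
    by exists g => p /gA; exact: lam_len.
  have [w lw] := cV p q pA qA; exists w; rewrite -(lam_len _ _ _ gV VU lw).
  by have [] := kA p q pA qA; split=> //; rewrite (lam_len _ _ _ gV VU lw).
Qed.

End Words.

(** Round up to a weight between [d + h] and [d + 2 h], where [h] is half of the
    allowed error: a word of two or more letters costs at least [d + 2 h], and
    one-letter words agree because the rounding depends on the value of [d]
    only. *)
Lemma good_approximation (R : realType) (G : zmodType) (d : G -> R) (l : seq G)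
    (e : R) : 0 < e ->
  (forall x, d x = 0 -> x = 0) -> d 0 = 0 -> (forall x, d (- x) = d x) ->
  (forall x y, d (x + y) <= d x + d y) ->
  exists W : seq (G * rat), good W /\
    forall x, x \in l -> x != 0 ->
      exists2 w, (x, w) \in W & `|ratr w - d x| < e.
Proof.
move=> e0 dsep d0 dN dD; pose h := e / 2.
have h0 : 0 < h by rewrite divr_gt0.
have /choice [q qP] : forall r : R, exists q : rat, r + h < ratr q < r + h + h.
  move=> r; have [q] := @rat_in_itvoo R (r + h) (r + h + h) ltac:(lra).
  by rewrite in_itv/=; exists q.
have dge0 x : 0 <= d x.
  by have := dD x (- x); rewrite subrr d0 dN => ?; lra.
pose W := [seq (x, q (d x)) | x <- l & x != 0].
have WP y w : (y, w) \in W -> y != 0 /\ w = q (d y).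
  by move=> /mapP[x]; rewrite mem_filter => /andP[x0 _] [-> ->].
have lW y w : letter W y w -> w = q (d y).
  by case=> /WP [_ ->]//; rewrite dN.
have wge n x c : word W n x c -> d x + h *+ n <= ratr c.
  elim=> [|{}n {}x {}c y w _ IH /lW ->]; first by rewrite d0 rmorph0 addr0.
  have /andP[qy _] := qP (d y); have := dD x y.
  by rewrite rmorphD /= mulrSr; lra.
exists W; split=> [y w /WP [y0 ->]|x xl x0]; last first.
  exists (q (d x)); first by apply/mapP; exists x; rewrite // mem_filter x0.
  have /andP[q1 q2] := qP (d x).
  by rewrite ltr_norml; move: q1 q2; rewrite /h; lra.
have /andP[qy1 qy2] := qP (d y).
split=> [|n c wd]; first by rewrite -(ltr0q R); have := dge0 y; lra.
case: wd (wge _ _ _ wd) y0 qy1 qy2 => [|{}n x {}c z v wx /lW ->].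
  by rewrite eqxx.
case: wx => [|{}n {}x {}c z' w' _ _]; first by rewrite !add0r.
rewrite -(ler_rat R) => + _ _ /ltW qy2 => dc.
apply: le_trans qy2 (le_trans _ dc); rewrite -addrA lerD2l.
by rewrite -mulr2n ler_pMn2l.
Qed.

(** * Isometries from one-point extensions *)

Section Extension.
Variable R : realType.
Implicit Types (X Y U : metricType R) (V : set R).

(** Katetov's condition on the distances from a new point, with an error [e]
    that makes it stable under small changes of the points and values. *)
Definition katetov X (e : R) (s : seq (X * R)) := forall p q, p \in s -> q \in s ->
  p.2 <= q.2 + mdist p.1 q.1 + e /\ mdist p.1 q.1 <= p.2 + q.2 + e.

Definition extension_property V X := forall s : seq (X * R),
  (forall p, p \in s -> V p.2) -> katetov 0 s ->
  exists y, forall p, p \in s -> mdist y p.1 = p.2.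

(** A prescription with a zero is realized by the point where it vanishes. *)
Lemma extension_property_positive V X :
  (forall s : seq (X * R), (forall p, p \in s -> V p.2) ->
     (forall p, p \in s -> 0 < p.2) -> katetov 0 s ->
     exists y, forall p, p \in s -> mdist y p.1 = p.2) ->
  extension_property V X.
Proof.
move=> ext s sV ks; have [[p [ps p0]]|nz] := pselect (exists p, p \in s /\ p.2 = 0).
  exists p.1 => q qs; have := ks p q ps qs; have := ks q p qs ps.
  by rewrite p0 (metric_sym q.1) => -[? ?] [? ?]; apply: le_anti; lra.
apply: ext => // p ps; have [_] := ks p p ps ps; rewrite mdistxx addr0 => p2.
rewrite lt_neqAle; apply/andP; split; last by lra.
by apply/eqP => p0; apply: nz; exists p.
Qed.

Definition distances_in V X := forall x y : X, V (mdist x y).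

(** Finite partial isometries are kept as graphs, so that [forth] and [back] are
    symmetric and both directions are subject to [directed_union]. *)
Definition partial_isometry_seq X Y (s : seq (X * Y)) :=
  forall p q, p \in s -> q \in s -> mdist p.1 q.1 = mdist p.2 q.2.

Lemma eq_of_close (a b : R) :
  (forall e, 0 < e -> a <= b + 4 * e /\ b <= a + 4 * e) -> a = b.
Proof.
move=> h; apply/eqP; rewrite eq_le; apply/andP; split; apply/ler_addgt0Pr => e e0.
  by have [|] := h (e / 4); rewrite ?divr_gt0//; lra.
by have [|] := h (e / 4); rewrite ?divr_gt0//; lra.
Qed.

Lemma forth V X Y (s : seq (X * Y)) x :
  distances_in V X -> extension_property V Y -> partial_isometry_seq s ->
  exists y, partial_isometry_seq ((x, y) :: s).
Proof.
move=> VX eY sP; have [_ /mapP[p _ ->]//||y yP] :=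
    eY [seq (p.2, mdist x p.1) | p <- s]; first exact: VX.
  move=> _ _ /mapP[p ps ->] /mapP[q qs ->] /=; rewrite -sP// !addr0.
  have := metric_triangle x q.1 p.1; have := metric_triangle p.1 x q.1.
  by rewrite (metric_sym q.1) (metric_sym p.1 x); split; lra.
have {}yP p : p \in s -> mdist y p.2 = mdist x p.1.
  by move=> ps; apply: (yP (p.2, _)); exact: (map_f (fun p => (p.2, mdist x p.1))).
exists y => p q /[!in_cons] /predU1P[->|ps] /predU1P[->|qs] /=.
- by rewrite !mdistxx.
- by rewrite yP.
- by rewrite metric_sym (metric_sym p.2) yP.
- exact: sP.
Qed.

Lemma back V X Y (s : seq (X * Y)) y :
  distances_in V Y -> extension_property V X -> partial_isometry_seq s ->
  exists x, partial_isometry_seq ((x, y) :: s).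
Proof.
move=> VY eX sP; have [||x xP] := @forth V Y X [seq (p.2, p.1) | p <- s] y VY.
- exact: eX.
- by move=> _ _ /mapP[p ps ->] /mapP[q qs ->] /=; rewrite sP.
pose sw (p : X * Y) := (p.2, p.1).
exists x => p q ps qs; rewrite (xP (sw p) (sw q))//.
  exact: (map_f sw ps).
exact: (map_f sw qs).
Qed.

Lemma back_and_forth V X Y (D : set X) (E : set Y) (s0 : seq (X * Y)) :
  countable D -> countable E -> distances_in V X -> distances_in V Y ->
  extension_property V Y -> (E !=set0 -> extension_property V X) ->
  partial_isometry_seq s0 ->
  exists S : set (X * Y),
    [/\ forall p q, S p -> S q -> mdist p.1 q.1 = mdist p.2 q.2,
        forall p, p \in s0 -> S p,
        forall x, D x -> exists y, S (x, y) &
        forall y, E y -> exists x, S (x, y)].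
Proof.
move=> cD cE VX VY eY eX s0P.
pose T := (inl @` D) `|` (inr @` E) : set (X + Y).
have cT : countable T.
  have [f finj] := countable_index cD; have [g ginj] := countable_index cE.
  apply/countable_injP; exists (fun t => pickle (match t return nat + nat with
    | inl x => inl (f x) | inr y => inr (g y) end)) => t t' /[!inE] tT t'T.
  move/(pcan_inj pickleK); move: tT t'T.
  case=> -[z Dz <-] [] [z' Dz' <-] // [] zz'; congr (_ _).
    by apply: finj => //; rewrite inE.
  by apply: ginj => //; rewrite inE.
pose achieved (t : X + Y) (s : seq (X * Y)) := match t with
  | inl x => exists y, (x, y) \in s | inr y => exists x, (x, y) \in s end.
have [s t sP|S [Sfin Sdone]] := directed_union (inv := @partial_isometry_seq X Y)
    (achieved := achieved) cT s0P.
  case=> -[z zDE <-].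
    have [y yP] := forth z VX eY sP; exists ((z, y) :: s); split=> //.
      by move=> p ps; rewrite in_cons ps orbT.
    by exists y; rewrite mem_head.
  have [|x xP] := back z VY _ sP; first by apply: eX; exists z.
  exists ((x, z) :: s); split=> //.
    by move=> p ps; rewrite in_cons ps orbT.
  by exists x; rewrite mem_head.
exists S; split=> [p q Sp Sq|p ps0|x Dx|y Ey].
- have [z|s [sP _ pqs _]] := Sfin [:: p; q].
    by rewrite !inE => /orP[]/eqP ->.
  by apply: sP; apply: pqs; rewrite !inE eqxx ?orbT.
- have [z|s [_ s0s _ sS]] := Sfin [::]; first by rewrite in_nil.
  exact/sS/s0s.
- have [|s [_ [y xy] sS]] := Sdone (inl x); first by left; exists x.
  by exists y; exact: sS.
- have [|s [_ [x xy] sS]] := Sdone (inr y); first by right; exists y.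
  by exists x; exact: sS.
Qed.

(** ** Completeness *)

(** Completeness in the form of Cantor's intersection theorem: it gives limits
    without filters or sequences, and estimates them at the same time. *)
Definition nested_family X (B : R -> set X) :=
  [/\ forall e, 0 < e -> B e !=set0,
      forall e e', 0 < e -> e <= e' -> B e `<=` B e' &
      forall e y z, 0 < e -> B e y -> B e z -> mdist y z <= e].

Definition nested_complete X := forall B : R -> set X, nested_family B ->
  exists y, forall e z, 0 < e -> B e z -> mdist y z <= e.

Lemma ball_mdist X (x y : X) e : ball x e y <-> mdist x y < e.
Proof. by rewrite ballEmdist. Qed.

Lemma complete_nested X : complete_space X -> nested_complete X.
Proof.
move=> cX B [B0 Bmono Bdiam].
pose F := filter_from [set e : R | 0 < e] B.
have FF : ProperFilter F.
  apply: filter_from_proper => [|e /B0//]; apply: filter_from_filter.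
    by exists 1 => /=.
  move=> e e' /= e0 e'0; exists (Num.min e e'); first by rewrite /= lt_min e0.
  by move=> z Bz; split; apply: Bmono Bz; rewrite ?lt_min ?e0// ge_min lexx ?orbT.
have [|y yP] := cX F FF.
  apply: cauchy_exP => e e0; have e20 : 0 < e / 2 by rewrite divr_gt0.
  have [z zB] := B0 (e / 2) e20; exists z, (e / 2) => // z' z'B.
  by apply/ball_mdist; have := Bdiam _ _ _ e20 zB z'B; lra.
exists y => e z e0 Bz; apply/ler_addgt0Pr => h h0.
have /yP [e' /= e'0 Be'] := nbhsx_ballx y h h0.
have m0 : 0 < Num.min e e' by rewrite lt_min e0.
have [z' Bz'] := B0 _ m0.
have z'1 : B e' z' by apply: Bmono Bz'; rewrite // ge_min lexx orbT.
have z'2 : B e z' by apply: Bmono Bz'; rewrite // ge_min lexx.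
move: (Be' _ z'1) => /ball_mdist yz'; have := Bdiam _ _ _ e0 z'2 Bz.
by have := metric_triangle y z' z; lra.
Qed.

Lemma nested_complete_space X : nested_complete X -> complete_space X.
Proof.
move=> nX F FF /cauchyP cF.
pose B e := [set y : X | F (ball y (e / 4))].
have [|y yP] := nX B.
  split=> [e e0|e e' e0 ee' y|e y z e0 By Bz].
  - by have [y Fy] := cF (e / 4) ltac:(lra); exists y.
  - by apply: filterS => z /ball_mdist yz; apply/ball_mdist; lra.
  - have [t [/ball_mdist yt /ball_mdist zt]] := filter_ex (filterI By Bz).
    by have := metric_triangle y t z; rewrite (metric_sym t); lra.
exists y => A /nbhs_ballP[e /= e0 eA].
have [z Fz] := cF (e / 2 / 4) ltac:(lra).
have yz := yP (e / 2) z ltac:(lra) Fz.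
apply: filterS Fz => t /ball_mdist zt; apply: eA; apply/ball_mdist.
by have := metric_triangle y z t; lra.
Qed.

Lemma dense_mdist X (D : set X) :
  dense D <-> forall x e, 0 < e -> exists2 y, D y & mdist x y < e.
Proof.
split=> [dD x e e0|dD O [x Ox] oO]; last first.
  have /nbhs_ballP [e /= e0 eO] := open_nbhs_nbhs (conj oO Ox).
  have [y Dy xy] := dD x e e0; exists y; split=> //; apply: eO.
  exact/ball_mdist.
have [|y [By Dy]] := dD (interior (ball x e)) _ (@open_interior _ _).
  by exists x; exact: nbhsx_ballx.
by exists y => //; apply/ball_mdist; exact: interior_subset By.
Qed.

(** A distance-preserving relation with dense domain is contained in the graph
    of an isometry, provided that the limit points exist: either its domain is
    everything or the target is complete. *)
Lemma isometric_relation_extends X Y (S : X -> Y -> Prop) :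
  (forall x y x' y', S x y -> S x' y' -> mdist x x' = mdist y y') ->
  (forall x e, 0 < e -> exists x' y', S x' y' /\ mdist x x' < e) ->
  complete_space Y \/ (forall x, exists y, S x y) ->
  exists f : X -> Y, forall x x' y', S x' y' -> mdist (f x) y' = mdist x x'.
Proof.
move=> Siso Sdense [/complete_nested cY|Stot]; last first.
  have /choice[f fP] := Stot; exists f => x x' y' Sx'.
  by rewrite (Siso _ _ _ _ (fP x) Sx').
suff /choice[f fP] : forall x, exists y, forall x' y', S x' y' ->
    mdist y y' = mdist x x' by exists f.
move=> x; pose B e := [set y | exists2 x', S x' y & mdist x x' <= e / 2].
have [|y yP] := cY B.
  split=> [e e0|e e' e0 ee' y [x' Sx' xx']|e y z e0 [x' Sx' xx'] [x2 Sx2 xx2]].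
  - have [|x' [y [Sx' xx']]] := Sdense x (e / 2); first by rewrite divr_gt0.
    by exists y, x' => //; exact: ltW.
  - by exists x' => //; lra.
  - rewrite -(Siso _ _ _ _ Sx' Sx2); have := metric_triangle x' x x2.
    by rewrite (metric_sym x' x); lra.
exists y => x' y' Sx'; apply: eq_of_close => e e0.
have [x2 [y2 [Sx2 xx2]]] := Sdense x e e0.
have By2 : B (2 * e) y2 by exists x2 => //; lra.
have yy2 := yP (2 * e) y2 ltac:(lra) By2.
have := metric_triangle y y2 y'; have := metric_triangle y2 y y'.
have := metric_triangle x x2 x'; have := metric_triangle x2 x x'.
rewrite (metric_sym y2 y) (metric_sym x2 x) -(Siso _ _ _ _ Sx2 Sx').
by split; lra.
Qed.

Lemma isometry_of_relation X Y (S : X -> Y -> Prop) (f : X -> Y) :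
  (forall x e, 0 < e -> exists x' y', S x' y' /\ mdist x x' < e) ->
  (forall x x' y', S x' y' -> mdist (f x) y' = mdist x x') ->
  Defs.isometry f /\ forall x y, S x y -> f x = y.
Proof.
move=> Sdense fP; split=> [x z|x y Sx]; last first.
  by apply: mdist_positivity; rewrite (fP _ _ _ Sx) mdistxx.
apply: eq_of_close => e e0; have [x' [y' [Sx' zx']]] := Sdense z e e0.
have fz := fP z _ _ Sx'; have := fP x _ _ Sx'.
have := metric_triangle (f x) (f z) y'; have := metric_triangle (f x) y' (f z).
have := metric_triangle x z x'; have := metric_triangle x x' z.
rewrite (metric_sym x' z) (metric_sym y' (f z)) fz.
by split; lra.
Qed.

(** Back-and-forth treats the points of [D]; the others are reached as limits
    when the space is complete, and there are none when [D] is everything. *)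
Definition enough_points X (D : set X) :=
  [/\ countable D, forall x e, 0 < e -> exists2 x', D x' & mdist x x' < e &
      complete_space X \/ D = setT].

Lemma contains_copy_criterion V X Y (D : set X) :
  countable D -> (forall x e, 0 < e -> exists2 x', D x' & mdist x x' < e) ->
  complete_space Y \/ D = setT ->
  distances_in V X -> distances_in V Y -> extension_property V Y ->
  contains_copy_of Y X.
Proof.
move=> cD dD lim VX VY eY.
have [|p q|S [Siso _ Sdom _]] :=
  @back_and_forth V X Y D set0 [::] cD (countable0 _) VX VY eY.
- by case.
- by rewrite in_nil.
pose S' x y := S (x, y).
have S'iso x y x' y' : S' x y -> S' x' y' -> mdist x x' = mdist y y'.
  exact: (Siso (x, y) (x', y')).
have S'dense x e : 0 < e -> exists x' y', S' x' y' /\ mdist x x' < e.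
  move=> /(dD x)[x' /Sdom[y' Sx'] xx'].
  by exists x', y'.
have [|f fP] := isometric_relation_extends S'iso S'dense.
  by case: lim => [|DT]; [left|right=> x; apply: Sdom; rewrite DT].
by exists f; have [] := isometry_of_relation S'dense fP.
Qed.

Lemma ultrahomogeneous_criterion V U (D : set U) :
  enough_points D -> distances_in V U -> extension_property V U ->
  ultrahomogeneous U.
Proof.
move=> [cD dD lim] VU eU A B h finA finB [[hAB hinj hsurj] hiso].
have /finite_seqP[s As] := finA.
have sA x : x \in s <-> A x by rewrite As.
have [|p q|S [Siso sS Sdom Sran]] :=
    @back_and_forth V U U D D [seq (x, h x) | x <- s] cD cD VU VU eU.
- by [].
- by move=> /mapP[x /sA Ax ->] /mapP[y /sA Ay ->] /=; rewrite hiso.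
pose S1 x y := S (x, y); pose S2 y x := S (x, y).
have S1iso x y x' y' : S1 x y -> S1 x' y' -> mdist x x' = mdist y y'.
  exact: (Siso (x, y) (x', y')).
have S2iso x y x' y' : S2 x y -> S2 x' y' -> mdist x x' = mdist y y'.
  by move=> Sx Sx'; rewrite -(S1iso _ _ _ _ Sx Sx').
have S1dense x e : 0 < e -> exists x' y', S1 x' y' /\ mdist x x' < e.
  by move=> /(dD x)[x' /Sdom[y' Sx'] xx']; exists x', y'.
have S2dense x e : 0 < e -> exists x' y', S2 x' y' /\ mdist x x' < e.
  by move=> /(dD x)[x' /Sran[y' Sx'] xx']; exists x', y'.
have [|f fP] := isometric_relation_extends S1iso S1dense.
  by case: lim => [|DT]; [left|right=> x; apply: Sdom; rewrite DT].
have [|g gP] := isometric_relation_extends S2iso S2dense.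
  by case: lim => [|DT]; [left|right=> x; apply: Sran; rewrite DT].
have [fiso fS] := isometry_of_relation S1dense fP.
have [giso gS] := isometry_of_relation S2dense gP.
exists f; last by move=> x Ax; apply/fS/sS/mapP; exists x => //; exact/sA.
split=> //; exists g => x; apply: mdist_positivity; apply/eqP;
  rewrite eq_le mdist_ge0 andbT; apply/ler_addgt0Pr => e e0; rewrite add0r.
- have [x' [y' [Sx' xx']]] := S1dense x (e / 2) ltac:(lra).
  have := metric_triangle (g (f x)) x' x; rewrite (metric_sym x' x).
  by rewrite (gP (f x) _ _ Sx') (fP x _ _ Sx'); lra.
- have [y' [x' [Sx' xx']]] := S2dense x (e / 2) ltac:(lra).
  have := metric_triangle (f (g x)) y' x; rewrite (metric_sym y' x).
  by rewrite (fP (g x) _ _ Sx') (gP x _ _ Sx'); lra.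
Qed.

(** Both criteria use the same back-and-forth: over all points, without limits,
    in the rational case, and over a dense sequence in the complete case. *)
Lemma rational_Urysohn_criterion X :
  countable [set: X] -> rational_distances X ->
  extension_property (range ratr) X -> is_rational_Urysohn X.
Proof.
move=> cX qX eX.
have ratV (Z : metricType R) : rational_distances Z -> distances_in (range ratr) Z.
  by move=> qZ x y; have [q ->] := qZ x y; exists q.
have dT (Z : metricType R) (x : Z) (e : R) : 0 < e ->
    exists2 x' : Z, [set: Z] x' & mdist x x' < e.
  by exists x; rewrite ?mdistxx.
split=> // [Z finZ qZ|].
  apply: (contains_copy_criterion (finite_set_countable finZ) (@dT Z)) eX.
  - by right.
  - exact: ratV.
  - exact: ratV.
apply: (@ultrahomogeneous_criterion _ _ setT) (ratV _ qX) eX.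
by split=> //; [exact: dT|right].
Qed.

Lemma Urysohn_criterion Y : complete_space Y -> separable Y ->
  extension_property setT Y -> is_Urysohn Y.
Proof.
move=> cY sY eY; split=> // [X [D cD /dense_mdist dD]|].
  by apply: (contains_copy_criterion cD dD) eY => //; left.
have [D cD /dense_mdist dD] := sY.
by apply: (@ultrahomogeneous_criterion _ _ D) eY => //; split=> //; left.
Qed.

(** * Approximate and exact extensions *)

(** The largest extension of a prescription to a function on [X] that grows at
    most as fast as the distance, [x |-> min_i (f_i + d(x, a_i))]. *)
Lemma largest_lipschitz_extension X (s : seq (X * R)) : s != [::] ->
  exists m : X -> R, forall x, (forall p, p \in s -> m x <= p.2 + mdist x p.1) /\
    exists2 p, p \in s & m x = p.2 + mdist x p.1.
Proof.
move=> s0; suff /choice[m mP] : forall x, exists r,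
    (forall p, p \in s -> r <= p.2 + mdist x p.1) /\
    exists2 p, p \in s & r = p.2 + mdist x p.1 by exists m.
move=> x; have [p ps pP] := seq_argmin (fun p => p.2 + mdist x p.1) s0.
by exists (p.2 + mdist x p.1); split=> //; exists p.
Qed.

(** An approximately admissible prescription [f] is within [e] of the admissible
    [min_j (f_j + d(-, a_j)) + e/2]. *)
Lemma approximate_extension V X e (s : seq (X * R)) :
  extension_property V X -> 0 <= e ->
  (forall p (x y : X), p \in s -> V (p.2 + mdist x y + e / 2)) -> katetov e s ->
  exists y, forall p, p \in s -> `|mdist y p.1 - p.2| <= e.
Proof.
move=> eX e0 VX ks; have [->|s0] := eqVneq s [::].
  have [||y _] := eX [::]; first by move=> p; rewrite in_nil.
    by move=> p q; rewrite in_nil.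
  by exists y => p; rewrite in_nil.
have [m mP] := largest_lipschitz_extension s0.
have [||y yP] := eX [seq (p.1, m p.1 + e / 2) | p <- s].
- move=> _ /mapP[p ps ->] /=; have [_ [q qs ->]] := mP p.1; exact: VX.
- move=> _ _ /mapP[p ps ->] /mapP[q qs ->] /=; rewrite !addr0.
  have [mp [p' p's mp']] := mP p.1; have [mq [q' q's mq']] := mP q.1.
  have := mp q' q's; have [_] := ks p' q' p's q's.
  have := metric_triangle p.1 q.1 q'.1; have := metric_triangle p.1 p'.1 q.1.
  have := metric_triangle p'.1 q'.1 q.1; rewrite (metric_sym q'.1 q.1).
  by rewrite mp' mq'; split; lra.
exists y => p ps; rewrite (yP (p.1, m p.1 + e / 2)) /=; last first.
  exact: (map_f (fun p => (p.1, m p.1 + e / 2))).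
have [mp [q qs mq]] := mP p.1; have := mp p ps; rewrite mdistxx.
by have [+ _] := ks p q ps qs; rewrite ler_norml mq; lra.
Qed.

(** From an approximate solution [y] with error [e], adding [y] itself to the
    problem at distance [e] yields a better one within [2 e] of [y]; the extended
    problem is consistent as long as [e] is at most every prescribed value. *)
Lemma approximate_extension_exact Y : complete_space Y ->
  (forall e (s : seq (Y * R)), 0 < e -> katetov 0 s ->
     exists y, forall p, p \in s -> `|mdist y p.1 - p.2| <= e) ->
  extension_property setT Y.
Proof.
move=> /complete_nested cY aY; apply: extension_property_positive => s _ spos ks.
have [c c0 cs] := seq_pos_lower_bound (F := fun p : Y * R => p.2) spos.
pose near_sol e y := forall p, p \in s -> `|mdist y p.1 - p.2| <= e.
have step e y : 0 < e -> e <= c -> near_sol e y ->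
    exists z, near_sol (e / 2) z /\ mdist y z <= 2 * e.
  move=> e0 ec ye; have [||z zP] := aY (e / 2) ((y, e) :: s); first by lra.
    move=> p q /[!in_cons] /predU1P[->|ps] /predU1P[->|qs] /=.
    - by rewrite mdistxx; lra.
    - by have := ye q qs; have := cs q qs; rewrite ler_norml; split; lra.
    - have := ye p ps; have := cs p ps; rewrite ler_norml (metric_sym p.1).
      by have := mdist_ge0 y p.1; split; lra.
    - exact: ks.
  exists z; split=> [p ps|]; first by apply: zP; rewrite in_cons ps orbT.
  by have := zP (y, e) (mem_head _ _); rewrite ler_norml metric_sym /=; lra.
pose u n := c / 2 ^+ n.
have u0 n : 0 < u n by rewrite divr_gt0// exprn_gt0.
have uS n : u n.+1 = u n / 2 by rewrite /u exprSr invfM mulrA.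
have uc n : u n <= c.
  by elim: n => [|n]; rewrite ?uS; [rewrite /u expr0 divr1|have := u0 n; lra].
have /choice[next nextP] : forall ny : nat * Y, exists z,
    near_sol (u ny.1) ny.2 -> near_sol (u ny.1.+1) z /\ mdist ny.2 z <= 2 * u ny.1.
  move=> [n y] /=; have [ny|] := pselect (near_sol (u n) y); last by exists y.
  by have [z zP] := step _ _ (u0 n) (uc n) ny; exists z => _; rewrite uS.
have [y0 y0P] := aY c s c0 ks.
pose v := fix v n := if n is m.+1 then next (m, v m) else y0.
have vP n : near_sol (u n) (v n).
  elim: n => [|n IH]; first by rewrite /u expr0 divr1.
  by have [] := nextP (n, v n) IH.
have vv n k : mdist (v n) (v (n + k)%N) <= 4 * u n - 4 * u (n + k)%N.
  elim: k => [|k IH]; first by rewrite addn0 mdistxx subrr.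
  rewrite addnS uS; have [_ /=] := nextP ((n + k)%N, v (n + k)%N) (vP _).
  by have := metric_triangle (v n) (v (n + k)%N) (v (n + k).+1) => /=; lra.
have vv' m n e : (m <= n)%N -> 4 * u m <= e -> mdist (v m) (v n) <= e.
  by move=> mn ue; have := vv m (n - m)%N; rewrite subnKC//; have := u0 n; lra.
pose B e := [set y | exists2 n, y = v n & 4 * u n <= e].
have usmall e : 0 < e -> exists n, 4 * u n <= e.
  move=> e0; exists (Num.Def.truncn (4 * c / e)); rewrite /u mulrA.
  rewrite ler_pdivrMr ?exprn_gt0// -ler_pdivrMl// mulrC.
  apply/ltW/(lt_le_trans (truncnS_gt _)).
  by rewrite -natrX ler_nat ltn_expl.
have [|y yP] := cY B.
  split=> [e /usmall[n un]|e e' _ ee' _ [n -> un]|e _ _ _ [n -> un] [m -> um]].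
  - by exists (v n), n.
  - by exists n => //; exact: le_trans ee'.
  - have [nm|/ltnW mn] := leqP n m; first exact: vv'.
    by rewrite metric_sym; exact: vv'.
exists y => p ps; apply: eq_of_close => e e0.
have [n un] := usmall e e0; have Bn : B e (v n) by exists n.
have := yP e (v n) e0 Bn; have := vP n p ps; have := u0 n.
have := metric_triangle y (v n) p.1; have := metric_triangle (v n) y p.1.
by rewrite (metric_sym (v n) y) ler_norml; split; lra.
Qed.

End Extension.
(** * One-point extensions of a metric space *)

Section OnePoint.
Variables (R : realType) (X : metricType R).

(** The positive admissible distance functions to a new point. *)
Record distance_function := DistanceFunction {
  dfun :> X -> R;
  dfun_gt0 : forall x, 0 < dfun x;
  dfun_lip : forall x y, dfun x <= dfun y + mdist x y;
  dfun_ge : forall x y, mdist x y <= dfun x + dfun y }.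

Definition one_point (f : distance_function) : Type := option X.

Variable f : distance_function.

Definition one_point_dist (a b : one_point f) : R :=
  match a, b with
  | Some x, Some y => mdist x y
  | Some x, None => f x
  | None, Some y => f y
  | None, None => 0
  end.

Lemma one_point_distxx a : one_point_dist a a = 0.
Proof. by case: a => [x|] //=; rewrite mdistxx. Qed.

Lemma one_point_dist_eq a b : one_point_dist a b = 0 -> a = b.
Proof.
case: a b => [x|] [y|] //=; first by move/mdist_positivity ->.
  by have := dfun_gt0 f x; move=> /[swap] ->; rewrite ltxx.
by have := dfun_gt0 f y; move=> /[swap] ->; rewrite ltxx.
Qed.

Lemma one_point_distC a b : one_point_dist a b = one_point_dist b a.
Proof. by case: a b => [x|] [y|] //=; rewrite metric_sym. Qed.

Lemma one_point_triangle b a c :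
  one_point_dist a c <= one_point_dist a b + one_point_dist b c.
Proof.
case: a b c => [x|] [y|] [z|] //=; rewrite ?add0r ?addr0//.
- exact: metric_triangle.
- by rewrite addrC; exact: dfun_lip.
- exact: dfun_ge.
- by rewrite metric_sym; exact: dfun_lip.
- by have := dfun_gt0 f y; lra.
Qed.

HB.instance Definition _ := Choice.copy (one_point f) (option X).

HB.instance Definition _ := @isMetric.Build R (one_point f) one_point_dist
  one_point_distxx one_point_dist_eq one_point_distC one_point_triangle.

Lemma one_point_separable : separable X -> separable (one_point f).
Proof.
move=> [D cD /dense_mdist dD].
exists [set a : one_point f | if a is Some x then D x else True].
  have [g ginj] := countable_index cD.
  apply/countable_injP; exists (fun a => if a is Some x then (g x).+1 else 0%N).
  move=> [x|] [y|] // /[!inE]/= Dx Dy [gxy]; congr Some.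
  by apply: ginj; rewrite ?inE.
apply/dense_mdist => -[x|] e e0; last by exists None; rewrite ?mdistxx.
by have [y Dy xy] := dD x e e0; exists (Some y).
Qed.

End OnePoint.

(** Embed the one-point extension of [U] determined by the prescription, then
    move the copy of the prescribed points back by homogeneity. *)
Lemma Urysohn_extension_property (R : realType) (U : metricType R) :
  U -> is_Urysohn U -> extension_property setT U.
Proof.
move=> u0 [_ sU univ homog]; apply: extension_property_positive => s _ spos ks.
have [->|s0] := eqVneq s [::]; first by exists u0 => p; rewrite in_nil.
have [m mP] := largest_lipschitz_extension s0.
have m0 x : 0 < m x.
  by have [_ [p /spos p0 ->]] := mP x; have := mdist_ge0 x p.1; lra.
have mlip x y : m x <= m y + mdist x y.
  have [_ [p ps ->]] := mP y; have [/(_ p ps) mx _] := mP x.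
  by have := metric_triangle x y p.1; lra.
have mge x y : mdist x y <= m x + m y.
  have [_ [p ps ->]] := mP x; have [_ [q qs ->]] := mP y.
  have [_] := ks p q ps qs; have := metric_triangle x p.1 y.
  by have := metric_triangle p.1 q.1 y; rewrite (metric_sym q.1 y); lra.
have ms p : p \in s -> m p.1 = p.2.
  move=> ps; have [/(_ p ps) + [q qs mq]] := mP p.1; rewrite mdistxx mq.
  by have [+ _] := ks p q ps qs; move=> ? ?; apply: le_anti; lra.
pose f := DistanceFunction m0 mlip mge.
have [j jiso] := univ (one_point f) (one_point_separable f sU).
pose A : set U := [set` [seq p.1 | p <- s]].
pose h (x : U) : U := j (Some x : one_point f).
have hiso x y : mdist (h x) (h y) = mdist x y.
  exact: (jiso (Some x : one_point f) (Some y : one_point f)).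
have finA : finite_set A by exact: finite_seq.
have [|g [[g' gK g'K] giso] gh] := homog A (h @` A) h finA (finite_image _ finA).
  split; last by move=> x y _ _; exact: hiso.
  split; [by move=> x Ax; exists x| |by []].
  by move=> x y _ _ hxy; apply: mdist_positivity; rewrite -hiso hxy mdistxx.
exists (g' (j (None : one_point f))) => p ps.
rewrite -giso g'K gh; last by exact: (map_f (fun p : U * R => p.1)).
rewrite (jiso (None : one_point f) (Some p.1 : one_point f)).
exact: ms.
Qed.

(** * Completion of a metric space *)

Section Completion.
Variables (R : realType) (X : metricType R).

(** A point of the completion is encoded by its distances to [X]. *)
Definition ideal_point : set (X -> R) := [set f |
  [/\ forall x y, f x <= f y + mdist x y,
      forall x y, mdist x y <= f x + f y &
      forall e, 0 < e -> exists x, f x < e]].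

Definition completion : Type := set_type ideal_point.

Implicit Types f g h : completion.

Definition to_fun f : X -> R := set_val f.
Local Coercion to_fun : completion >-> Funclass.

Lemma ideal_lip f x y : f x <= f y + mdist x y.
Proof. by have [lip _ _] := set_valP f; exact: lip. Qed.

Lemma ideal_ge f x y : mdist x y <= f x + f y.
Proof. by have [_ ge _] := set_valP f; exact: ge. Qed.

Lemma ideal_small f e : 0 < e -> exists x, f x < e.
Proof. by have [_ _ small] := set_valP f; exact: small. Qed.

Lemma ideal_ge0 f x : 0 <= f x.
Proof. by have := ideal_ge f x x; rewrite mdistxx; lra. Qed.

(** In the completion this infimum is the distance, since [X] is dense. *)
Definition completion_dist f g : R := inf (range (fun x => f x + g x)).

Lemma completion_dist_le f g x : completion_dist f g <= f x + g x.
Proof.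
apply: ge_inf; last by exists x.
by exists 0 => _ [y _ <-]; rewrite addr_ge0// ideal_ge0.
Qed.

Lemma le_completion_dist f g a :
  (forall x, a <= f x + g x) -> a <= completion_dist f g.
Proof.
move=> h; apply: lb_le_inf; last by move=> _ [x _ <-].
by have [x _] := ideal_small f ltr01; exists (f x + g x), x.
Qed.

Lemma completion_distxx f : completion_dist f f = 0.
Proof.
apply: le_anti; apply/andP; split.
  apply/ler_addgt0Pr => e e0; have [x fx] := @ideal_small f (e / 2) ltac:(lra).
  by have := completion_dist_le f f x; lra.
by apply: le_completion_dist => x; rewrite addr_ge0// ideal_ge0.
Qed.

Lemma completion_distC f g : completion_dist f g = completion_dist g f.
Proof.
by congr inf; apply/seteqP; split=> _ [x _ <-]; exists x; rewrite // addrC.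
Qed.

Lemma ideal_le_dist f g x : f x <= g x + completion_dist f g.
Proof.
rewrite -lerBlDl; apply: le_completion_dist => z.
by have := ideal_lip f x z; have := ideal_ge g x z; lra.
Qed.

Lemma completion_dist_eq f g : completion_dist f g = 0 -> f = g.
Proof.
move=> fg; apply/val_inj/funext => x; apply: le_anti; apply/andP; split.
  by have := ideal_le_dist f g x; rewrite fg addr0.
by have := ideal_le_dist g f x; rewrite completion_distC fg addr0.
Qed.

Lemma completion_triangle g f h :
  completion_dist f h <= completion_dist f g + completion_dist g h.
Proof.
rewrite -lerBlDr; apply: le_completion_dist => x; rewrite lerBlDr.
by have := completion_dist_le f h x; have := ideal_le_dist h g x;
   rewrite (completion_distC h); lra.
Qed.

HB.instance Definition _ := Choice.copy completion (set_type ideal_point).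

HB.instance Definition _ := @isMetric.Build R completion completion_dist
  completion_distxx completion_dist_eq completion_distC completion_triangle.

Lemma ideal_point_mdist x : ideal_point (mdist x).
Proof.
split=> [y z|y z|e e0]; last by exists x; rewrite mdistxx.
- by rewrite (metric_sym y); exact: metric_triangle.
- by rewrite (metric_sym x y); exact: metric_triangle.
Qed.

Definition to_completion x : completion := SigSub (mem_set (ideal_point_mdist x)).

Lemma to_completionE x y : to_completion x y = mdist x y. Proof. by []. Qed.

Lemma mdist_to_completion x f : mdist (to_completion x) f = f x.
Proof.
apply: le_anti; apply/andP; split.
  by apply: le_trans (completion_dist_le _ _ x) _; rewrite to_completionE mdistxx add0r.
apply: le_completion_dist => y; rewrite to_completionE.
by have := ideal_lip f x y; rewrite addrC.
Qed.

Lemma completion_nested_complete : nested_complete completion.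
Proof.
move=> B [B0 Bmono Bdiam].
have close e e' (z z' : completion) x :
    0 < e -> 0 < e' -> B e z -> B e' z' -> z x - e <= z' x + e'.
  move=> e0 e'0 Bz Bz'; have h := ideal_le_dist z z' x.
  suff : completion_dist z z' <= e + e' by lra.
  have [ee'|/ltW ee'] := lerP e e'.
    by have := Bdiam _ _ _ e'0 (Bmono _ _ e0 ee' _ Bz) Bz'; rewrite /mdist/=; lra.
  by have := Bdiam _ _ _ e0 Bz (Bmono _ _ e'0 ee' _ Bz'); rewrite /mdist/=; lra.
(* The limit is the supremum of the lower estimates [z x - e], for [z] in [B e]. *)
pose A x := [set r | exists e z, [/\ 0 < e, B e z & r = to_fun z x - e]].
pose y x := sup (A x).
have ylow e (z : completion) x : 0 < e -> B e z -> z x - e <= y x.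
  move=> e0 Bz; apply: ub_le_sup; last by exists e, z.
  exists (z x + e) => _ [e' [z' [e'0 Bz' ->]]]; exact: close.
have yup e (z : completion) x : 0 < e -> B e z -> y x <= z x + e.
  move=> e0 Bz; apply: ge_sup; first by exists (z x - e), e, z.
  by move=> _ [e' [z' [e'0 Bz' ->]]]; exact: close.
have yideal : ideal_point y.
  split=> [x x'|x x'|e e0].
  - apply/ler_addgt0Pr => e e0; have e20 : 0 < e / 2 by rewrite divr_gt0.
    have [z Bz] := B0 (e / 2) e20.
    have := yup _ _ x e20 Bz; have := ylow _ _ x' e20 Bz.
    by have := ideal_lip z x x'; lra.
  - apply/ler_addgt0Pr => e e0; have e20 : 0 < e / 2 by rewrite divr_gt0.
    have [z Bz] := B0 (e / 2) e20.
    have := ylow _ _ x e20 Bz; have := ylow _ _ x' e20 Bz.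
    by have := ideal_ge z x x'; lra.
  - have e20 : 0 < e / 2 by rewrite divr_gt0.
    have [z Bz] := B0 (e / 2) e20.
    have [x zx] := @ideal_small z (e / 2) e20.
    by exists x; have := yup _ _ x e20 Bz; lra.
pose Y : completion := SigSub (mem_set yideal).
exists Y => e z e0 Bz; apply/ler_addgt0Pr => h h0.
have [x zx] := @ideal_small z (h / 2) ltac:(lra).
have := completion_dist_le Y z x; have := yup _ _ x e0 Bz.
have -> : to_fun Y x = y x by [].
by rewrite /mdist/=; lra.
Qed.

Lemma completion_is_completion : is_completion X completion.
Proof.
split; first exact/nested_complete_space/completion_nested_complete.
exists to_completion.
  by move=> x y; rewrite mdist_to_completion to_completionE metric_sym.
apply/dense_mdist => f e /(ideal_small f)[x fx]; exists (to_completion x).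
  by exists x.
by rewrite metric_sym mdist_to_completion.
Qed.

End Completion.

(** * Recognizing a dense subset of the Urysohn space *)

Section NearlyUrysohn.
Variable R : realType.
Implicit Types X Y U : metricType R.

(** The hypothesis is a weak inequality and the conclusion a strict one, which
    makes this implication an open condition on the metric. *)
Definition nearly_solved X (k : nat) (s : seq (X * rat)) :=
  katetov (k.+1%:R^-1 : R) [seq (p.1, ratr p.2) | p <- s] ->
  exists g, forall p, p \in s -> `|mdist g p.1 - ratr p.2| < 2 * k.+1%:R^-1.

Definition nearly_Urysohn X := forall k (s : seq (X * rat)), nearly_solved k s.

Lemma inv_succ_small (e : R) : 0 < e -> exists k : nat, (k.+1%:R^-1 : R) < e.
Proof.
move=> e0; exists (Num.Def.truncn e^-1).
by rewrite invf_plt ?posrE// ?truncnS_gt// ltr0n.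
Qed.

Lemma rat_close (r e : R) : 0 < e -> exists q : rat, `|ratr q - r| < e.
Proof.
move=> e0; have [|q] := @rat_in_itvoo R (r - e) (r + e); first by lra.
by rewrite in_itv/= => /andP[? ?]; exists q; rewrite ltr_norml; lra.
Qed.

(** A problem in the completion is rounded to one in [X] with rational values,
    at the price of an error [h] in its consistency. *)
Lemma nearly_Urysohn_completion X Y : countable [set: X] -> is_completion X Y ->
  nearly_Urysohn X -> is_Urysohn Y.
Proof.
move=> cX [cY [i iiso /dense_mdist idense]] nX.
apply: Urysohn_criterion => //.
  exists (range i); last exact/dense_mdist.
  exact: sub_countable (card_image_le _ _) cX.
apply: approximate_extension_exact => // e s e0 ks.
have [k ke] := @inv_succ_small (e / 4) ltac:(lra).
have : 0 < k.+1%:R^-1 :> R by rewrite invr_gt0 ltr0n.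
move: ke (nX k); rewrite /nearly_solved; set h := _^-1 => ke nXk h0.
have h40 : 0 < h / 4 by lra.
have /choice[a aP] : forall y, exists x, mdist y (i x) < h / 4.
  by move=> y; have [_ [x _ <-]] := idense y _ h40; exists x.
have /choice[q qP] : forall r : R, exists q : rat, `|ratr q - r| < h / 4.
  by move=> r; exact: rat_close.
have [|g gP] := nXk [seq (a p.1, q p.2) | p <- s].
  move=> _ _ /mapP[_ /mapP[u us ->] ->] /mapP[_ /mapP[v vs ->] ->] /=.
  have [] := ks u v us vs; rewrite -iiso.
  have := qP u.2; have := qP v.2; have := aP u.1; have := aP v.1.
  have := metric_triangle u.1 (i (a u.1)) v.1.
  have := metric_triangle (i (a u.1)) (i (a v.1)) v.1.
  have := metric_triangle (i (a u.1)) u.1 (i (a v.1)).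
  have := metric_triangle u.1 v.1 (i (a v.1)).
  rewrite (metric_sym (i (a u.1)) u.1) (metric_sym (i (a v.1)) v.1) !ltr_norml.
  by split; lra.
exists (i g) => p ps; have := gP (a p.1, q p.2) (map_f _ ps); rewrite -iiso /=.
have := qP p.2; have := aP p.1; have := metric_triangle (i g) p.1 (i (a p.1)).
have := metric_triangle (i g) (i (a p.1)) p.1.
rewrite (metric_sym (i (a p.1))) !ltr_norml ler_norml.
by lra.
Qed.

(** An approximately consistent problem has an approximate solution in the
    Urysohn space, which is then moved to a nearby point of [X]. *)
Lemma Urysohn_completion_nearly X : X -> completion_isometric_to_Urysohn X ->
  nearly_Urysohn X.
Proof.
move=> x0 [Y [_ [i iiso /dense_mdist idense]] [U UU [f [f' fK f'K] fiso]]] k s ks.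
have k0 : 0 < k.+1%:R^-1 :> R by rewrite invr_gt0 ltr0n.
have eU := Urysohn_extension_property (f (i x0)) UU.
have [| | |u uP] := @approximate_extension R setT U k.+1%:R^-1
    [seq (f (i p.1), ratr p.2) | p <- s] eU.
- exact: ltW.
- by [].
- move=> _ _ /mapP[p ps ->] /mapP[q qs ->] /=; rewrite fiso iiso.
  apply: (ks (p.1, ratr p.2) (q.1, ratr q.2)).
    exact: (map_f (fun p => (p.1, ratr p.2))).
  exact: (map_f (fun p => (p.1, ratr p.2))).
have [_ [g _ <-] ug] := idense (f' u) _ k0.
exists g => p ps.
have := uP (f (i p.1), ratr p.2)
  (map_f (fun p => (f (i p.1), ratr p.2)) ps).
rewrite -{1}(f'K u) fiso -iiso /=.
have := metric_triangle (i g) (f' u) (i p.1).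
have := metric_triangle (f' u) (i g) (i p.1).
rewrite (metric_sym (i g) (f' u)) ler_norml ltr_norml.
by move: k0 ug; set h : R := _^-1; lra.
Qed.

Lemma completion_isometric_to_UrysohnP X : X -> countable [set: X] ->
  completion_isometric_to_Urysohn X <-> nearly_Urysohn X.
Proof.
move=> x0 cX; split=> [|nX]; first exact: Urysohn_completion_nearly.
exists (completion X); first exact: completion_is_completion.
exists (completion X); last by exists id => //; exists id.
exact: nearly_Urysohn_completion (completion_is_completion X) nX.
Qed.

Lemma rational_nearly_Urysohn X : rational_distances X ->
  extension_property (range ratr) X -> nearly_Urysohn X.
Proof.
move=> qX eX k s ks.
have k0 : 0 < k.+1%:R^-1 :> R by rewrite invr_gt0 ltr0n.
have [| |y yP] := approximate_extension eX _ _ ks.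
- exact: ltW.
- move=> _ x y /mapP[p ps ->] /=; have [q ->] := qX x y.
  exists (p.2 + q + k.+1%:R^-1 / 2) => //.
  by rewrite !rmorphD/= !rmorphM/= !fmorphV/= !ratr_nat.
exists y => p ps; apply: le_lt_trans (yP (p.1, ratr p.2) _) _.
  exact: (map_f (fun p => (p.1, ratr p.2))).
by rewrite ltr_pMl// ltr1n.
Qed.

End NearlyUrysohn.

(** * The space of invariant metrics *)

Section InvariantMetrics.
Variables (R : realType) (G : zmodType).
Implicit Types d : invariant_metrics R G.

Lemma mdist_metrized d (a b : metrized d) : mdist a b = set_val d (a : G, b : G).
Proof. by []. Qed.

Lemma evaluation_near d (p : G * G) (e : R) : 0 < e ->
  \forall d' \near d, `|set_val d' p - set_val d p| < e.
Proof.
move=> e0.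
have np := @proj_continuous _ (fun _ : G * G => R) p (set_val d) _
  (nbhsx_ballx (set_val d p : R) e e0).
have : nbhs d [set d' : invariant_metrics R G | ball (set_val d p : R) e (set_val d' p)].
  exact: (@initial_continuous _ _ (@set_val _ (invariant_metrics R G)) d _ np).
by apply: filterS => d'; rewrite distrC.
Qed.

(** A basic neighbourhood in the topology of pointwise convergence constrains
    finitely many values. *)
Lemma dense_pointwise (E : set (invariant_metrics R G)) :
  (forall d (l : seq (G * G)) e, 0 < e -> exists2 d', E d' &
     forall p, p \in l -> `|set_val d' p - set_val d p| < e) ->
  dense E.
Proof.
move=> dE O [d Od] [A oA AO].
pose F := filter_from [set le : seq (G * G) * R | 0 < le.2]
  (fun le => [set f : {ptws (G * G) -> R} |
     forall p, p \in le.1 -> `|f p - set_val d p| < le.2]).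
have FF : Filter F.
  apply: filter_from_filter; first by exists ([::], 1) => /=.
  move=> [l e] [l' e'] /= e0 e'0.
  exists (l ++ l', Num.min e e'); first by rewrite /= lt_min e0.
  move=> f /= fP; split=> p pl.
    by have := fP p; rewrite mem_cat pl lt_min => /(_ isT)/andP[].
  by have := fP p; rewrite mem_cat pl orbT lt_min => /(_ isT)/andP[].
have Fd : {ptws, F --> set_val d}.
  apply/cvg_sup => p U [V] [[W oW <-] Wd WU].
  have /nbhs_ballP[e /= e0 eW] : nbhs (set_val d p) W.
    by apply: open_nbhs_nbhs; split.
  exists ([:: p], e) => // f /= /(_ p); rewrite mem_head distrC => /(_ isT) fp.
  exact/WU/eW.
have nA : nbhs (set_val d : {ptws (G * G) -> R}) A.
  by apply: open_nbhs_nbhs; split=> //; rewrite -AO in Od.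
have [[l e] /= e0 leA] := Fd A nA.
have [d' Ed' d'l] := dE d l e e0; exists d'; split=> //.
by rewrite -AO; exact: leA.
Qed.

Lemma nearly_solved_open k (s : seq (G * rat)) :
  open [set d | @nearly_solved R (metrized d) k s].
Proof.
rewrite openE => d; rewrite /interior /= => solved.
set h : R := k.+1%:R^-1.
have [ks|nks] := pselect (@katetov R (metrized d) h [seq (p.1, ratr p.2) | p <- s]).
  have [g gP] := solved ks.
  have : \forall d' \near d, forall p, p \in s ->
      `|set_val d' (g : G, p.1) - ratr p.2| < 2 * h.
    apply: (near_all (P := fun p d' => `|set_val d' (g : G, p.1) - ratr p.2| < 2 * h)
      (nbhs_filter d)) => p ps.
    have := gP p ps; rewrite mdist_metrized => gp.
    have e0 : 0 < 2 * h - `|set_val d (g : G, p.1) - ratr p.2| by rewrite subr_gt0.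
    apply: filterS (evaluation_near d (g : G, p.1) e0) => d' dd'.
    have := ler_normD (set_val d' (g : G, p.1) - set_val d (g : G, p.1))
      (set_val d (g : G, p.1) - ratr p.2).
    by rewrite subrKA; lra.
  by apply: filterS => d' d'P _; exists g => p ps; exact: d'P.
suff : \forall d' \near d,
    ~ @katetov R (metrized d') h [seq (p.1, ratr p.2) | p <- s].
  by apply: filterS => d' nk /nk.
have [u [v [us vs nuv]]] : exists u v : G * R,
  [/\ u \in [seq (p.1, ratr p.2) | p <- s], v \in [seq (p.1, ratr p.2) | p <- s] &
      v.2 + set_val d (u.1, v.1) + h < u.2 \/
      u.2 + v.2 + h < set_val d (u.1, v.1)].
  apply: contrapT => nuv; apply: nks => u v us vs.
  split; rewrite leNgt; apply/negP => lt; apply: nuv; exists u, v;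
    split=> //; [by left|by right].
pose defect1 := u.2 - (v.2 + set_val d (u.1, v.1) + h).
pose defect2 := set_val d (u.1, v.1) - (u.2 + v.2 + h).
pose gap := Num.max defect1 defect2.
have gap0 : 0 < gap by rewrite lt_max !subr_gt0; case: nuv => ->; rewrite ?orbT.
apply: filterS (evaluation_near d (u.1, v.1) gap0) => d' dd' kd'.
have [] := kd' u v us vs; rewrite mdist_metrized => k1 k2.
by move: dd'; rewrite /gap ltr_norml; have [_|_] := lerP defect1 defect2;
  rewrite /defect1 /defect2; lra.
Qed.

(** The data are indexed by natural numbers through an injection; the numbers
    that are not an index contribute the whole space. *)
Lemma completion_Urysohn_Gdelta : countable [set: G] ->
  Gdelta [set d : invariant_metrics R G |
            completion_isometric_to_Urysohn (metrized d)].
Proof.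
move=> cG; have [f finj] := countable_index (countable_seq rat cG).
exists (fun n => [set d | forall k s, pickle (k, f s) = n ->
                            @nearly_solved R (metrized d) k s]).
  move=> n; have [[k [s ksn]]|nks] := pselect (exists (k : nat) s, pickle (k, f s) = n).
    rewrite (_ : mkset _ = [set d | @nearly_solved R (metrized d) k s]).
      exact: nearly_solved_open.
    apply/seteqP; split=> d /=; first exact.
    move=> dks k' s'; rewrite -ksn => /(pcan_inj pickleK)[-> fss'].
    by rewrite (finj s' s) ?inE.
  rewrite (_ : mkset _ = setT); first exact: openT.
  by apply/seteqP; split=> // d _ k s ksn; case: nks; exists k, s.
apply/seteqP; split=> d.
  by move/(completion_isometric_to_UrysohnP (0 : metrized d) cG) => h n _ k s _.
move=> h; apply/(completion_isometric_to_UrysohnP (0 : metrized d) cG) => k s.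
exact: (h (pickle (k, f s)) I k s).
Qed.

(** ** Metrics from universal length functions *)

Definition length_dist (lam : G -> rat) (p : G * G) : R := ratr (lam (p.1 - p.2)).

Lemma length_dist_invariant lam : universal_length lam ->
  is_invariant_metric (length_dist lam).
Proof.
move=> [lam0 lamN lamD _]; split.
- by move=> a; rewrite /length_dist subrr (lam0 0).2// rmorph0.
- move=> a b /eqP; rewrite /length_dist/= fmorph_eq0 => /eqP/lam0/eqP.
  by rewrite subr_eq0 => /eqP.
- by move=> a b; rewrite /length_dist/= -lamN opprB.
- move=> b a c; rewrite /length_dist/= -rmorphD ler_rat.
  by rewrite -[a - c](subrKA b).
- by move=> a b c; rewrite /length_dist/= opprD addrACA subrr addr0.
Qed.

Definition length_metric lam (lamU : universal_length lam) :
  invariant_metrics R G := SigSub (mem_set (length_dist_invariant lamU)).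

Lemma length_metric_rational lam (lamU : universal_length lam) :
  rational_distances (metrized (length_metric lamU)).
Proof. by move=> a b; exists (lam (a - b)). Qed.

Lemma length_metric_extension lam (lamU : universal_length lam) :
  extension_property (range ratr) (metrized (length_metric lamU)).
Proof.
apply: extension_property_positive => s sV spos ks.
set X := metrized _ in s sV spos ks *.
have /choice[q qP] : forall r : R, exists q : rat, range ratr r -> r = ratr q.
  move=> r; have [[q _ <-]|nr] := pselect (range (ratr : rat -> R) r).
    by exists q.
  by exists 0.
have sq p : p \in s -> p.2 = ratr (q p.2) by move=> /sV/qP.
have [_ _ _ ext] := lamU.
have [_ /mapP[p ps ->]|_ _ /mapP[u us ->] /mapP[v vs ->]|g gP] :=
  ext [seq (p.1 : G, q p.2) | p <- s].
- by rewrite -(ltr0q R) -sq//; exact: spos.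
- rewrite -!(ler_rat R) !rmorphD /= -!sq//.
  by have := ks u v us vs; rewrite !addr0 !mdist_metrized.
exists g => p ps; rewrite mdist_metrized (sq _ ps); congr ratr.
exact: (gP (p.1 : G, q p.2) (map_f (fun p => (p.1 : G, q p.2)) ps)).
Qed.

Lemma universal_lengths_dense : countable [set: G] -> unbounded_group G ->
  dense [set d | exists lam (lamU : universal_length lam), d = length_metric lamU].
Proof.
move=> cG hG; apply: dense_pointwise => d l e e0.
have dP : is_invariant_metric (set_val d) by exact: set_valP.
have dE a b : set_val d (a, b) = set_val d (a - b, 0).
  by rewrite (invm_invariant dP a b (- b)) subrr.
have [||||W [gW lW]] :=
    @good_approximation R G (fun x => set_val d (x, 0)) [seq p.1 - p.2 | p <- l] e e0.
- by move=> x /(invm_sep dP).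
- exact: invm_refl dP _.
- by move=> x; rewrite -(sub0r x) -dE (invm_sym dP).
- move=> x y; apply: le_trans (invm_triangle dP y _ _) _.
  by rewrite dE addrK.
have [lam lamU lamW] := universal_length_extension cG hG gW.
exists (length_metric lamU); first by exists lam, lamU.
move=> [a b] abl; rewrite dE.
have -> : set_val (length_metric lamU) (a, b) = ratr (lam (a - b)) by [].
have [->|ab] := eqVneq (a - b) 0.
  have [lam0 _ _ _] := lamU.
  by rewrite (lam0 0).2// rmorph0 (invm_refl dP) subrr normr0.
have [w wW] := lW _ (map_f (fun p => p.1 - p.2) abl) ab.
by rewrite (lamW _ wW).
Qed.

End InvariantMetrics.

Theorem theorem0p1 (R : realType) (G : zmodType)
    (hcount : countable [set: G]) (hunb : unbounded_group G) :
  dense [set d : invariant_metrics R G |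
          isometric_to_rational_Urysohn (metrized d)] /\
  (dense [set d : invariant_metrics R G |
           completion_isometric_to_Urysohn (metrized d)] /\
   Gdelta [set d : invariant_metrics R G |
            completion_isometric_to_Urysohn (metrized d)]).
Proof.
have dns := @universal_lengths_dense R G hcount hunb.
split; [|split; last exact: completion_Urysohn_Gdelta].
- move=> O O0 oO; have [d [Od [lam [lamU ed]]]] := dns O O0 oO.
  exists d; split=> //=; rewrite ed.
  exists (metrized (length_metric R lamU)); last by exists id => //; exists id.
  apply: (@rational_Urysohn_criterion R (metrized (length_metric R lamU)) hcount).
    exact: length_metric_rational.
  exact: length_metric_extension.
- move=> O O0 oO; have [d [Od [lam [lamU ed]]]] := dns O O0 oO.
  exists d; split=> //=; rewrite ed.
  apply/(completion_isometric_to_UrysohnP (0 : metrized _) hcount).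
  apply: rational_nearly_Urysohn; first exact: length_metric_rational.
  exact: length_metric_extension.
Qed.
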